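(* Let $M$ be a matroid on a finite ground set $E$. The (geometric realization of the) augmented Bergman complex $\Delta_M$ is homotopy equivalent to a $\beta$-fold wedge of $(r(M)-1)$-spheres, where $\beta$ has the two expressions $$\beta=\#\mathcal{B}(M)\ \ (=T_M(1,1)),$$ $$\beta=\sum_{F\in\mathcal{F}(M)} T_{M|_F}(0,1)\cdot T_{M/F}(1,0).$$ The first and second expressions are predicted by the flag-to-basis shellings and the basis-to-flag shellings of $\Delta_M$, respectively: any flag-to-basis shelling of $\Delta_M$ has exactly $\#\mathcal{B}(M)$ homology facets, and any basis-to-flag shelling of $\Delta_M$ has exactly $\sum_{F\in\mathcal{F}(M)} T_{M|_F}(0,1)\cdot T_{M/F}(1,0)$ homology facets.
   Context: Let $M$ be a matroid on a finite set $E$, with independent sets $\mathcal{I}(M)$ (a simplicial complex), bases $\mathcal{B}(M)$ (maximal independent sets), lattice of flats $\mathcal{F}(M)$ ordered by inclusion, rank function $r$, rank $r(M)=r(E)$, and closure $A\mapsto\overline{A}$ (smallest flat containing $A$). The Tutte polynomial is $T_M(x,y)=\sum_{A\subseteq E}(x-1)^{r(M)-r(A)}(y-1)^{\#A-r(A)}$. The Bergman complex $\underline{\Delta}_M$ is the order complex (simplices = totally ordered subsets) of the poset $\mathcal{F}(M)\setminus\{\overline{\varnothing},E\}$. The augmented Bergman complex $\Delta_M$ is the abstract simplicial complex on vertex set $\{y_i : i\in E\}\sqcup\{x_F : F\in\mathcal{F}(M)\setminus\{E\}\}$ whose simplices are the subsets $\{y_i\}_{i\in I}\cup\{x_{F_1},\ldots,x_{F_\ell}\}$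 with $I\in\mathcal{I}(M)$, $\ell\ge0$, and flats satisfying $I\subseteq F_1\subsetneq F_2\subsetneq\cdots\subsetneq F_\ell\ (\subsetneq E)$. It is pure of dimension $r(M)-1$. Its facets are the simplices $\{y_i\}_{i\in I}\cup\{x_{F_1},\ldots,x_{F_\ell}\}$ (with $I\in\mathcal{I}(M)$, $\ell\ge 0$, and flats $I\subseteq F_1\subsetneq F_2\subsetneq\cdots\subsetneq F_\ell\subsetneq E$) for which $\#I+\ell=r(M)$ and, if $\ell\ge1$, $F_1=\overline{I}$. Such a facet is written $\phi\leftrightarrow(I,F_\bullet)$, where $F_\bullet$ denotes the chain $F_1\subsetneq\cdots\subsetneq F_\ell$ (the empty chain when $I$ is a basis, in which case one sets $F_1:=\overline{I}=E$). When $r(M)=0$ the complex is $\{\varnothing\}$ and $\mathbb{S}^{-1}$ is understood as the empty space. Shelling: for a pure simplicial complex (with finitely many facets), a total order $\prec$ on its facets is a shelling order if for all facets $\phi\prec\phi'$ there exists a facet $\phi''\prec\phi'$ such that $\phi\cap\phi'\subseteq\phi''\cap\phi'$ and $\#(\phi''\cap\phi')=\#\phi'-1$. Given a shelling order, a facet $\phi$ is a homology facet of the shelling if for every vertex $x\in\phi$ there is a facet $\phi'\prec\phi$ with $\phi\setminus\{x\}\subset\phi'$. For a flat $F$, $M|_F$ is the restriction, with $\mathcal{I}(M|_F)=\mathcal{I}(M)\cap 2^F$, and $M/F$ is the contraction, with $\mathcal{F}(M/F)=\{G\setminus F: G\in\mathcal{F}(M), G\supseteq F\}$; thus $\mathcal{F}(M/F)$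 is identified with the interval $[F,E]$ of $\mathcal{F}(M)$. For a flat $F\ne E$, facets of $\underline{\Delta}_{M/F}$ are thereby identified with the maximal chains $F=F_1\subsetneq F_2\subsetneq\cdots\subsetneq F_\ell\subsetneq E$, i.e. with chains $F_\bullet$ having $F_1=F$ (by recording $F_2,\dots,F_\ell$). The complexes $\mathcal{I}(N)$ and $\underline{\Delta}_N$ are known to be shellable for every matroid $N$; their shellings have $T_N(0,1)$ homology facets and (for loopless $N$) $T_N(1,0)$ homology facets, respectively. Fix for each flat $F\neq E$ a shelling order of $\underline{\Delta}_{M/F}$, and for each flat $F$ a shelling order of $\mathcal{I}(M|_F)$. A total order $\prec$ on the facets of $\Delta_M$ is a flag-to-basis ordering if (for some choice of these shellings) two facets $\phi\leftrightarrow(I,F_\bullet)$, $\phi'\leftrightarrow(I',F'_\bullet)$ satisfy $\phi\prec\phi'$ whenever either (a) $\#I<\#I'$, or (b) $I=I'$ (so $F_1=F'_1$) and $F_\bullet$ strictly precedes $F'_\bullet$ in the chosen shelling of $\underline{\Delta}_{M/F_1}$. It is a basis-to-flag ordering if (for some choice of these shellings) $\phi\prec\phi'$ whenever (a) $\#I>\#I'$, or (b) $F_1=F'_1$ and $F_\bullet$ strictly precedes $F'_\bullet$ in the chosen shelling of $\underline{\Delta}_{M/F_1}$, or (c) $F_\bullet=F'_\bullet$ (so $\overline{I}=F_1=F_1'=\overline{I'}$) and $I$ strictly precedes $I'$ in the chosen shelling of $\mathcal{I}(M|_{F_1})$. Both kinds of orderings are shelling orders of $\Delta_M$ and are called flag-to-basis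 shellings and basis-to-flag shellings. *)

(* Defs.v *)
From HB Require Import structures.
From mathcomp Require Import all_boot all_order all_algebra.

Set Implicit Arguments.
Unset Strict Implicit.
Unset Printing Implicit Defensive.

Import Order.TTheory GRing.Theory Num.Theory.

(* The ground set is a subset of an ambient finite type, so that restrictions
   and contractions of a matroid over T are again matroids over T. *)
Record matroid (T : finType) := Matroid {
  ground : {set T};
  indep : {set {set T}};
  indep_ground : forall I : {set T}, I \in indep -> I \subset ground;
  indep0 : set0 \in indep;
  indep_sub : forall I J : {set T}, J \in indep -> I \subset J -> I \in indep;
  indep_aug : forall I J : {set T}, I \in indep -> J \in indep -> #|I| < #|J| ->
    exists2 x, x \in J :\: I & x |: I \in indep }.

(* A simplicial complex with vertices in V is given by its set of simplices. *)
Section Complexes.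
Variable V : finType.
Implicit Types (K : {set {set V}}) (lt : rel {set V}).

Definition facets K : {set {set V}} := [set s | maxset (mem K) s].

Definition strict_total_on (S : {set {set V}}) lt : Prop :=
  [/\ {in S, irreflexive lt},
      {in S & &, transitive lt} &
      {in S &, forall s t, s != t -> lt s t || lt t s}].

Definition shelling K lt : Prop :=
  strict_total_on (facets K) lt /\
  {in facets K &, forall s t, lt s t ->
    exists u, [/\ u \in facets K, lt u t, s :&: t \subset u :&: t &
                  #|u :&: t|.+1 = #|t| ]}.

Definition homology_facets K lt : {set {set V}} :=
  [set s in facets K |
    [forall x in s, [exists t in facets K, lt t s && (s :\ x \subset t)]]].

End Complexes.

Section MatroidTheory.
Variable T : finType.
Implicit Types (M : matroid T) (A B F G I J : {set T}).

Definition bases M : {set {set T}} := facets (indep M).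

Definition rk M A : nat := \max_(I in indep M | I \subset A) #|I|.

Definition flats M : {set {set T}} :=
  [set F : {set T} | (F \subset ground M) &&
    [forall x in ground M :\: F, rk M F < rk M (x |: F)]].

Definition cl M A : {set T} := \bigcap_(F in flats M | A \subset F) F.

Lemma rk_geq M I A : I \in indep M -> I \subset A -> #|I| <= rk M A.
Proof.
by move=> iI sIA; apply: (@leq_bigmax_cond _ _ (fun I => #|I|)); rewrite iI.
Qed.

Lemma rk_witness M A :
  exists I, [/\ I \in indep M, I \subset A & #|I| = rk M A].
Proof.
have /(eq_bigmax_cond (fun I => #|I|)) [I] :
    0 < #|[pred I in indep M | I \subset A]|.
  by apply/card_gt0P; exists set0; rewrite inE indep0 sub0set.
by rewrite inE => /andP[iI sIA] eI; exists I; split; rewrite // -eI.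
Qed.

Lemma rk_subadd M A B : rk M (A :|: B) <= rk M A + #|B|.
Proof.
have [J [iJ sJ <-]] := rk_witness M (A :|: B).
rewrite -(cardsID B J) addnC leq_add ?subset_leq_card ?subsetIr //.
apply: rk_geq; first by apply: indep_sub iJ _; apply: subsetDl.
by rewrite subDset setUC.
Qed.

Lemma rk_mono M A B : A \subset B -> rk M A <= rk M B.
Proof.
move=> sAB; have [J [iJ sJ <-]] := rk_witness M A.
exact: rk_geq (subset_trans sJ sAB).
Qed.

Section Restriction.
Variables (M : matroid T) (F : {set T}).

Definition restr_indep : {set {set T}} := [set I in indep M | I \subset F].

Lemma restr_indep_ground I : I \in restr_indep -> I \subset ground M :&: F.
Proof. by rewrite inE subsetI => /andP[/indep_ground-> ->]. Qed.

Lemma restr_indep0 : set0 \in restr_indep.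
Proof. by rewrite inE indep0 sub0set. Qed.

Lemma restr_indep_sub I J : J \in restr_indep -> I \subset J -> I \in restr_indep.
Proof.
rewrite !inE => /andP[iJ sJF] sIJ.
by rewrite (indep_sub iJ sIJ) (subset_trans sIJ).
Qed.

Lemma restr_indep_aug I J : I \in restr_indep -> J \in restr_indep ->
  #|I| < #|J| -> exists2 x, x \in J :\: I & x |: I \in restr_indep.
Proof.
rewrite !inE => /andP[iI sIF] /andP[iJ sJF] ltIJ.
have [x xJI ixI] := indep_aug iI iJ ltIJ; exists x => //.
rewrite inE ixI subUset sub1set sIF andbT.
by move: xJI; rewrite inE => /andP[_ /(subsetP sJF)].
Qed.

Definition mrestriction : matroid T :=
  Matroid restr_indep_ground restr_indep0 restr_indep_sub restr_indep_aug.
End Restriction.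

(* I is independent in M/F when r(I u F) = #I + r(F); flats_mcontraction below
   gives the description of M/F by its flats. *)
Section Contraction.
Variables (M : matroid T) (F : {set T}).

Definition contr_indep : {set {set T}} :=
  [set I : {set T} | (I \subset ground M :\: F) &&
    (rk M (I :|: F) == #|I| + rk M F)].

Lemma contr_indep_ground I : I \in contr_indep -> I \subset ground M :\: F.
Proof. by rewrite inE => /andP[]. Qed.

Lemma contr_indep0 : set0 \in contr_indep.
Proof. by rewrite inE sub0set set0U cards0 eqxx. Qed.

Lemma contr_indep_sub I J : J \in contr_indep -> I \subset J -> I \in contr_indep.
Proof.
rewrite !inE => /andP[sJ /eqP rJ] sIJ; rewrite (subset_trans sIJ) //=.
rewrite eqn_leq setUC addnC rk_subadd /= -(leq_add2r #|J :\: I|) -addnA.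
rewrite -{1}(setIidPr sIJ) cardsID addnC -rJ.
apply: leq_trans (rk_subadd _ _ _); apply: rk_mono; apply/subsetP=> x.
by rewrite !inE; case: (x \in F); case: (x \in I); case: (x \in J).
Qed.

Lemma contr_indep_aug I J : I \in contr_indep -> J \in contr_indep ->
  #|I| < #|J| -> exists2 x, x \in J :\: I & x |: I \in contr_indep.
Proof.
rewrite !inE => /andP[sI /eqP rI] /andP[sJ /eqP rJ] ltIJ.
have [KI [iKI sKI cKI]] := rk_witness M (I :|: F).
have [KJ [iKJ sKJ cKJ]] := rk_witness M (J :|: F).
have [|x] := indep_aug iKI iKJ; first by rewrite cKI cKJ rI rJ ltn_add2r.
rewrite inE => /andP[xKI xKJ] ixK.
have xIF : x \notin I :|: F.
  apply/negP => xIF; suff: #|x |: KI| <= rk M (I :|: F).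
    by rewrite cardsU1 xKI cKI ltnn.
  by apply: rk_geq => //; rewrite subUset sub1set xIF.
have /(subsetP sKJ) := xKJ; rewrite inE => xJF.
move: xIF; rewrite inE negb_or => /andP[xI xF].
have xJ : x \in J by move: xJF; rewrite (negPf xF) orbF.
exists x; first by rewrite inE xI.
rewrite inE subUset sub1set sI andbT (subsetP sJ) //=.
rewrite eqn_leq setUC addnC rk_subadd /= addnC cardsU1 xI -addnA -rI -cKI.
have -> : true + #|KI| = #|x |: KI| by rewrite cardsU1 xKI.
by apply: rk_geq => //; rewrite [F :|: _]setUC -setUA; apply: setUS.
Qed.

Definition mcontraction : matroid T :=
  Matroid contr_indep_ground contr_indep0 contr_indep_sub contr_indep_aug.
End Contraction.

Lemma rk_extend M I A : I \in indep M -> I \subset A ->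
  exists J, [/\ J \in indep M, I \subset J, J \subset A & #|J| = rk M A].
Proof.
move=> iI sIA; have [n] := ubnP (rk M A - #|I|).
elim: n I iI sIA => // n IHn I iI sIA; rewrite ltnS => len.
have := rk_geq iI sIA; rewrite leq_eqVlt => /predU1P[eI | ltI].
  by exists I; split.
have [K [iK sK cK]] := rk_witness M A.
have [|x] := indep_aug iI iK; first by rewrite cK.
rewrite inE => /andP[xI xK] ixI.
have [||J [iJ sJ sJA cJ]] := IHn _ ixI.
- by rewrite subUset sub1set (subsetP sK).
- by apply: leq_trans len; rewrite cardsU1 xI ltn_sub2l.
by exists J; split=> //; apply: subset_trans sJ; apply: subsetUr.
Qed.

Lemma rk_mcontraction M F A : A \subset ground M :\: F ->
  rk (mcontraction M F) A + rk M F = rk M (A :|: F).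
Proof.
move=> sA; apply/eqP; rewrite eqn_leq; apply/andP; split.
  have [I [iI sI <-]] := rk_witness (mcontraction M F) A.
  move: iI; rewrite inE => /andP[_ /eqP <-].
  by apply: rk_mono; apply: setSU.
have [B [iB sB cB]] := rk_witness M F.
have [J [iJ sBJ sJ cJ]] := rk_extend iB (subset_trans sB (subsetUr A F)).
have sJA : J :\: F \subset A by rewrite subDset setUC.
have cJF : #|J :&: F| = rk M F.
  apply/eqP; rewrite eqn_leq; apply/andP; split.
    by apply: rk_geq; rewrite ?subsetIr // (indep_sub iJ) ?subsetIl.
  by rewrite -cB subset_leq_card // subsetI sBJ.
rewrite -cJ -(cardsID F J) cJF addnC leq_add2r.
apply: rk_geq => //; rewrite inE (subset_trans sJA sA) /=.
rewrite eqn_leq setUC addnC rk_subadd /= -cJF cardsID.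
by apply: rk_geq => //; rewrite -subDset.
Qed.

Lemma flats_mcontraction M F : F \subset ground M ->
  flats (mcontraction M F) = [set G :\: F | G in [set G in flats M | F \subset G]].
Proof.
move=> sF; apply/setP=> A; apply/idP/imsetP.
  rewrite inE => /andP[sA /forall_inP fA].
  have dA : (A :|: F) :\: F = A.
    apply/setP=> y; have := subsetP sA y; rewrite !inE.
    by case: (y \in F); case: (y \in A) => //= ->.
  exists (A :|: F); last by rewrite dA.
  rewrite !inE subsetUr andbT subUset sF andbT.
  rewrite (subset_trans sA) ?subsetDl //=; apply/forall_inP=> x.
  rewrite !inE negb_or => /andP[/andP[xA xF] xE].
  have xA' : x |: A \subset ground M :\: F by rewrite subUset sub1set !inE xF xE.
  rewrite setUA -(rk_mcontraction sA) -(rk_mcontraction xA').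
  rewrite ltn_add2r; apply: fA.
  by rewrite !inE xA xF.
case=> G; rewrite !inE => /andP[/andP[sG /forall_inP fG] sFG] ->.
have dG : (G :\: F) :|: F = G by rewrite setUC setDE setUIr setUCr setIT; apply/setUidPr.
rewrite setSD //=; apply/forall_inP=> x; rewrite !inE => /andP[xG /andP[xF xE]].
have xG' : x |: (G :\: F) \subset ground M :\: F.
  by rewrite subUset sub1set !inE xF xE setSD.
rewrite -(ltn_add2r (rk M F)) (rk_mcontraction (setSD F sG)).
rewrite (rk_mcontraction xG') -setUA dG.
by apply: fG; rewrite inE xE andbT; move: xG; rewrite xF.
Qed.

Section TutteDef.
Local Open Scope ring_scope.
Definition tutte M : {poly {poly int}} :=
  \sum_(A : {set T} | A \subset ground M)
    ('X - 1) ^+ (rk M (ground M) - rk M A)%N * ('Y - 1) ^+ (#|A| - rk M A)%N.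
End TutteDef.

Definition is_chain (C : {set {set T}}) : bool :=
  [forall F in C, forall G in C, (F \subset G) || (G \subset F)].

Definition order_complex (P : {set {set T}}) : {set {set {set T}}} :=
  [set C : {set {set T}} | (C \subset P) && is_chain C].

Definition bergman M : {set {set {set T}}} :=
  order_complex (flats M :\: [set cl M set0; ground M]).

(* inl i is the vertex y_i and inr F is the vertex x_F; as y_i for a loop i, or
   for i outside the ground set, lies in no simplex, T + {set T} can be used as
   the vertex type. *)
Definition ypart (s : {set T + {set T}}) : {set T} := [set i | inl i \in s].
Definition xpart (s : {set T + {set T}}) : {set {set T}} := [set F | inr F \in s].

Definition aug_bergman M : {set {set T + {set T}}} :=
  [set s : {set T + {set T}} |
    [&& ypart s \in indep M, xpart s \subset flats M :\ ground M,
        is_chain (xpart s) & [forall F in xpart s, ypart s \subset F]]].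

(* For a facet s <-> (I, F_1 < ... < F_l), this is F_1; it is E when l = 0. *)
Definition first_flat M (s : {set T + {set T}}) : {set T} := cl M (ypart s).

(* The facet {F_2 \ F_1, ..., F_l \ F_1} of bergman (M/F_1). *)
Definition flag M (s : {set T + {set T}}) : {set {set T}} :=
  [set G :\: first_flat M s | G in xpart s :\ first_flat M s].

Definition bergman_shellings M (sh : {set T} -> rel {set {set T}}) : Prop :=
  {in flats M, forall F, F != ground M ->
    shelling (bergman (mcontraction M F)) (sh F)}.

Definition indep_shellings M (sh : {set T} -> rel {set T}) : Prop :=
  {in flats M, forall F, shelling (indep (mrestriction M F)) (sh F)}.

Definition flag_to_basis M (lt : rel {set T + {set T}}) : Prop :=
  strict_total_on (facets (aug_bergman M)) lt /\
  exists2 sh, bergman_shellings M sh &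
    {in facets (aug_bergman M) &, forall s t,
      #|ypart s| < #|ypart t| \/
      [/\ ypart s = ypart t, first_flat M s != ground M &
          sh (first_flat M s) (flag M s) (flag M t)] -> lt s t}.

Definition basis_to_flag M (lt : rel {set T + {set T}}) : Prop :=
  strict_total_on (facets (aug_bergman M)) lt /\
  exists shB shI, [/\ bergman_shellings M shB, indep_shellings M shI &
    {in facets (aug_bergman M) &, forall s t,
      [\/ #|ypart t| < #|ypart s|,
          [/\ first_flat M s = first_flat M t, first_flat M s != ground M &
              shB (first_flat M s) (flag M s) (flag M t)] |
          xpart s = xpart t /\
          shI (first_flat M s) (ypart s) (ypart t)] -> lt s t}].

End MatroidTheory.

From mathcomp Require Import all_classical all_reals all_analysis wedge_sigT.
Import numFieldNormedType.Exports.

Local Open Scope ring_scope.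
Local Open Scope classical_set_scope.

Section Topology.
Variable R : realType.

Definition realization_set (V : finType) (K : {set {set V}}) :
    set {ptws V -> R} :=
  [set x : {ptws V -> R} | [/\ forall v, 0 <= x v, \sum_v x v = 1 &
               [set v | x v != 0]%SET \in K]].

Definition realization (V : finType) (K : {set {set V}}) : topologicalType :=
  realization_set K.

Definition homotopic (X Y : topologicalType) (f g : X -> Y) : Prop :=
  exists H : X * R -> Y,
    {within [set: X] `*` `[0%R, 1%R], continuous H} /\
    forall x, H (x, 0) = f x /\ H (x, 1) = g x.

Definition homotopy_equivalent (X Y : topologicalType) : Prop :=
  exists (f : X -> Y) (g : Y -> X),
    [/\ continuous f, continuous g,
        homotopic (g \o f) idfun & homotopic (f \o g) idfun].

(* The unit sphere of R^n, of dimension n - 1; it is empty for n = 0. *)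
Definition sphere (n : nat) : set 'rV[R]_n :=
  [set x : 'rV[R]_n | \sum_i x ord0 i ^+ 2 = 1].
Arguments sphere n _ : clear implicits.

Lemma sphere_base_subproof n : (delta_mx ord0 ord0 : 'rV[R]_n.+1) \in sphere n.+1.
Proof.
rewrite inE /sphere /= (bigD1 ord0) //= big1 ?mxE ?eqxx ?expr1n ?addr0 //.
by move=> i /negPf ni; rewrite mxE ni andbF expr0n.
Qed.

Definition sphere_base n : sphere n.+1 :=
  exist _ (delta_mx ord0 ord0) (sphere_base_subproof n).

(* The b-fold wedge of (n - 1)-spheres, for b > 0. For n = 0 there is no base
   point: the space is the empty sphere, and only b = 1 is meaningful. *)
Definition sphere_wedge (b n : nat) : topologicalType :=
  match n with
  | 0 => sphere 0
  | m.+1 => wedge (fun _ : 'I_b => sphere_base m)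
  end.

End Topology.

Arguments sphere R n _ : clear implicits.

(* Main.v *)
Require Import Defs.
From mathcomp Require Import all_boot all_order all_algebra.
From mathcomp Require Import polyXY all_reals.
From mathcomp Require Import ring lra.

Set Implicit Arguments.
Unset Strict Implicit.
Unset Printing Implicit Defensive.

Import Order.TTheory GRing.Theory Num.Theory.

(** Combinatorics.  A shelling of a complex [K] splits the face poset into the
    intervals between the restriction of a facet and the facet itself, so when
    [K] is pure the number of homology facets is, up to sign, the reduced Euler
    characteristic of [K].  This gives T(0,1) for independence complexes and, by
    the Moebius recursion over closures, T(1,0) for Bergman complexes; a facet
    (I, F) is a homology facet of a basis-to-flag ordering exactly when I and F
    both are.  The equality of the two expressions of beta is the convolution
    formula of Kook, Reiner and Stanton, where the alternating sum over
    I <= A <= C vanishes unless I = C.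

    Topology.  The levels of a point of the realization, seen as weights [a] on
    the vertices y_i and [c] on the vertices x_F, give a flow: at time [t] the
    mass of [a] below height [t] is moved to the flats spanned by the superlevel
    sets of [a] (see [flow]).  Away from the open simplices spanned by the bases
    it contracts the complex to the vertex of the closure of the empty set.
    Inside the simplex of a basis the flow is applied after pushing the point
    off the barycentre (see [slide]).  Collapsing everything outside these open
    simplices, and spreading each sphere over a basis simplex together with the
    contraction of its boundary, are mutually inverse up to homotopy. *)

(** * Rank and flats *)

(** The flow can stay inside the complex because superlevel sets shrink as the level rises: their
    closures form a chain, contained in every flat that already carries mass and containing the
    elements whose weight exceeds the current time. Levels above every weight have closure
    [cl M set0], whose vertex dominates in the long run; since the flow is homogeneous, infinite
    time amounts to scaling the point to 0 at time 1. The obstacle is a superlevel set that spans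
    the ground set: no vertex can receive its mass. This happens only when the y-support contains a
    basis, hence is one, so there the flow must wait until a coordinate vanishes. In rank n the
    coordinates of a point of a basis simplex sum to 1, so their minimum l is at most 1/n, and 1 - 2
    n l runs from 1 on the boundary to -1 at the barycentre. Where it is negative, an inner simplex
    is blown up to the whole simplex; where it is positive, its value is the time of the flow in a
    collar; the two regions agree at value 0. *)

Section MatroidRank.
Variables (T : finType) (M : matroid T).
Implicit Types (A B C F G I J : {set T}).

Lemma rk_indep I : I \in indep M -> rk M I = #|I|.
Proof.
move=> iI; apply/eqP; rewrite eqn_leq rk_geq // andbT.
by have [J [_ sJ <-]] := rk_witness M I; rewrite subset_leq_card.
Qed.

Lemma rk0 : rk M set0 = 0.
Proof. by rewrite rk_indep ?indep0 // cards0. Qed.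

Lemma rk_leq_card A : rk M A <= #|A|.
Proof. by have [J [_ sJ <-]] := rk_witness M A; rewrite subset_leq_card. Qed.

Lemma rk_ground A : rk M A <= rk M (ground M).
Proof.
have [J [iJ _ <-]] := rk_witness M A.
exact: rk_geq (indep_ground iJ).
Qed.

Lemma rk_eq_card A : A \subset ground M -> (rk M A == #|A|) = (A \in indep M).
Proof.
move=> sA; apply/eqP/idP => [rA | /rk_indep //].
have [J [iJ sJ cJ]] := rk_witness M A.
by have <- : J = A by apply/eqP; rewrite eqEcard sJ cJ rA /=.
Qed.

(** A basis of [A] extends to a basis [J] of [C]. Augmenting [J] from a basis of [x |: C] can only
    add [x], and the independence of [x |: J] passes down to [A]. *)
Lemma rk_setU1_gt A C x : A \subset C -> rk M C < rk M (x |: C) ->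
  rk M A < rk M (x |: A).
Proof.
move=> sAC ltC.
have [I [iI sI cI]] := rk_witness M A.
have [J [iJ sIJ sJ cJ]] := rk_extend iI (subset_trans sI sAC).
have [K [iK sK cK]] := rk_witness M (x |: C).
have [|y] := indep_aug iJ iK; first by rewrite cJ cK.
rewrite inE => /andP[yJ yK] iyJ.
have eyx : y = x.
  have /(subsetP sK) := yK; rewrite !inE => /predU1P[//|yC].
  have := rk_geq iyJ (_ : y |: J \subset C).
  by rewrite subUset sub1set yC sJ cardsU1 yJ -cJ ltnn; move/(_ isT).
have ixI : x |: I \in indep M.
  by apply: indep_sub iyJ _; rewrite eyx setUS.
have := rk_geq ixI (setUS [set x] sI); apply: leq_trans.
rewrite cardsU1 -cI (_ : x \notin I) //.
by rewrite -eyx; apply: contra yJ => /(subsetP sIJ).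
Qed.

Lemma flat_subset F : F \in flats M -> F \subset ground M.
Proof. by rewrite inE => /andP[]. Qed.

Lemma flat_rk_lt F x : F \in flats M -> x \in ground M -> x \notin F ->
  rk M F < rk M (x |: F).
Proof.
by rewrite inE => /andP[_ /forall_inP fF] xE xF; apply: fF; rewrite inE xF.
Qed.

Lemma flatP F : F \subset ground M ->
  (forall x, x \in ground M -> x \notin F -> rk M F < rk M (x |: F)) ->
  F \in flats M.
Proof.
move=> sF hF; rewrite inE sF; apply/forall_inP => x.
by rewrite inE => /andP[xF xE]; apply: hF.
Qed.

Lemma ground_flat : ground M \in flats M.
Proof. by apply: flatP => // x ->. Qed.

Lemma flatI F G : F \in flats M -> G \in flats M -> F :&: G \in flats M.
Proof.
move=> fF fG; apply: flatP => [|x xE].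
  by rewrite subIset // (flat_subset fF).
rewrite inE negb_and => /orP[] xN.
  exact: rk_setU1_gt (subsetIl F G) (flat_rk_lt fF xE xN).
exact: rk_setU1_gt (subsetIr F G) (flat_rk_lt fG xE xN).
Qed.

Lemma flat_rk_proper F G : F \in flats M -> G \subset ground M ->
  F \proper G -> rk M F < rk M G.
Proof.
move=> fF sG /properP[sFG [x xG xF]].
apply: leq_trans (flat_rk_lt fF (subsetP sG x xG) xF) _.
by apply: rk_mono; rewrite subUset sub1set xG.
Qed.

Lemma flat_rk_inj F G : F \in flats M -> G \subset ground M ->
  F \subset G -> rk M G <= rk M F -> F = G.
Proof.
move=> fF sG sFG rGF; apply/eqP; rewrite eqEproper sFG /=.
by apply/negP => /(flat_rk_proper fF sG); rewrite ltnNge rGF.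
Qed.

Lemma cl_sub A : A \subset cl M A.
Proof. by apply/bigcapsP => F /andP[]. Qed.

Lemma cl_min A F : F \in flats M -> A \subset F -> cl M A \subset F.
Proof. by move=> fF sAF; apply: bigcap_inf; rewrite fF. Qed.

Lemma cl_flat A : A \subset ground M -> cl M A \in flats M.
Proof.
move=> sA; apply: flatP => [|x xE xN]; first exact: cl_min ground_flat sA.
have [F /andP[fF sAF] xF] : exists2 F, (F \in flats M) && (A \subset F) & x \notin F.
  apply/exists_inP; rewrite -negb_forall_in; apply: contra xN.
  by move=> /forall_inP h; apply/bigcapP.
exact: rk_setU1_gt (cl_min fF sAF) (flat_rk_lt fF xE xF).
Qed.

Lemma cl_ground A : A \subset ground M -> cl M A \subset ground M.
Proof. by move=> /cl_flat/flat_subset. Qed.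

Lemma flat_cl F : F \in flats M -> cl M F = F.
Proof. by move=> fF; apply/eqP; rewrite eqEsubset cl_min // cl_sub. Qed.

(** The elements that do not raise the rank of [A] form a flat [C] of the same rank, and the closure
    lies inside it. *)
Lemma rk_cl A : A \subset ground M -> rk M (cl M A) = rk M A.
Proof.
move=> sA; apply/eqP; rewrite eqn_leq (rk_mono _ (cl_sub A)) andbT.
pose C := [set x in ground M | rk M (x |: A) == rk M A].
have sAC : A \subset C.
  apply/subsetP => x xA; rewrite inE (subsetP sA) //=.
  by rewrite (_ : x |: A = A) //; apply/setUidPr; rewrite sub1set.
have rC : rk M C = rk M A.
  apply/eqP; rewrite eqn_leq (rk_mono _ sAC) andbT.
  have [I [iI sI cI]] := rk_witness M A.
  have [J [iJ sIJ sJ cJ]] := rk_extend iI (subset_trans sI sAC).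
  rewrite -cJ -cI subset_leq_card //; apply/subsetP => x xJ.
  apply/negPn/negP => xI.
  have ixI : x |: I \in indep M.
    by apply: indep_sub iJ _; rewrite subUset sub1set xJ.
  have := subsetP sJ _ xJ; rewrite inE => /andP[_ /eqP rx].
  have := rk_geq ixI (setUS [set x] sI).
  by rewrite rx cardsU1 xI -cI ltnn.
have fC : C \in flats M.
  apply: flatP => [|x xE xC]; first by apply/subsetP => x; rewrite inE => /andP[].
  rewrite rC; apply: leq_trans (rk_mono _ (setUS [set x] sAC)).
  move: xC; rewrite inE xE /= => rx.
  by rewrite ltn_neqAle eq_sym rx rk_mono // subsetUr.
by rewrite -rC; apply: rk_mono; apply: cl_min.
Qed.

Lemma cl_indep_flat I F : I \in indep M -> F \in flats M -> I \subset F ->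
  rk M F = #|I| -> cl M I = F.
Proof.
move=> iI fF sIF rF; have sI := indep_ground iI.
apply: flat_rk_inj (cl_flat sI) (flat_subset fF) (cl_min fF sIF) _.
by rewrite rF rk_cl // rk_indep.
Qed.

(** Take nested bases [I] and [J] of the two flats; the closure of a set of size [k] between them
    has the required rank. *)
Lemma flat_interpolate F G k : F \in flats M -> G \in flats M -> F \subset G ->
  rk M F <= k <= rk M G ->
  exists H, [/\ H \in flats M, F \subset H, H \subset G & rk M H = k].
Proof.
move=> fF fG sFG /andP[Fk kG].
have [I [iI sI cI]] := rk_witness M F.
have [J [iJ sIJ sJ cJ]] := rk_extend iI (subset_trans sI sFG).
have exK : exists K : {set T}, [/\ I \subset K, K \subset J & #|K| = k].
  rewrite -cI in Fk; move: kG; rewrite -cJ.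
  elim: k Fk => [|k IHk].
    rewrite leqn0 cards_eq0 => /eqP -> _; exists set0.
    by rewrite !sub0set cards0.
  rewrite leq_eqVlt => /predU1P[cIk _|Ik kJ]; first by exists I; split.
  have [||K [sIK sKJ cK]] := IHk; rewrite ?(ltnW kJ) //.
  have [x xJ xK] : exists2 x, x \in J & x \notin K.
    apply/subsetPn; apply: contraL kJ => /subset_leq_card.
    by rewrite cK -leqNgt.
  exists (x |: K); rewrite subUset sub1set xJ cardsU1 xK cK; split=> //.
  exact: subset_trans sIK (subsetUr _ _).
have [K [sIK sKJ cK]] := exK.
have iK : K \in indep M by apply: indep_sub iJ sKJ.
have sK := indep_ground iK.
exists (cl M K); split; first exact: cl_flat.
- have <- : cl M I = F by apply: cl_indep_flat.
  exact: cl_min (cl_flat sK) (subset_trans sIK (cl_sub K)).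
- by apply: cl_min => //; apply: subset_trans sKJ sJ.
- by rewrite rk_cl // rk_indep.
Qed.

Lemma basesP B :
  reflect (B \in indep M /\ #|B| = rk M (ground M)) (B \in bases M).
Proof.
rewrite inE; apply: (iffP maxsetP) => -[iB mB]; split=> //.
  have [J [iJ sJ _ cJ]] := rk_extend iB (indep_ground iB).
  by rewrite -cJ; congr #|_|; rewrite (mB J).
move=> C iC sBC; apply/esym/eqP; rewrite eqEcard sBC mB.
exact: rk_geq (indep_ground iC).
Qed.

Lemma indep_card_leq I : I \in indep M -> #|I| <= rk M (ground M).
Proof. by move=> iI; apply: rk_geq (indep_ground iI). Qed.

Lemma card_bases_gt0 : 0 < #|bases M|.
Proof.
have [J [iJ _ cJ]] := rk_witness M (ground M).
by apply/card_gt0P; exists J; apply/basesP.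
Qed.

Lemma indep_sup_basis B I : B \in bases M -> I \in indep M -> B \subset I -> I = B.
Proof.
move=> /basesP[iB cB] iI sBI; apply/esym/eqP.
by rewrite eqEcard sBI cB indep_card_leq.
Qed.

Lemma flat_sup_basis B F : B \in bases M -> F \in flats M -> B \subset F ->
  F = ground M.
Proof.
move=> /basesP[iB cB] fF sBF.
apply: (flat_rk_inj fF) => //; first exact: flat_subset.
by rewrite -cB rk_geq.
Qed.

Lemma indep_sub_proper_flat I : I \in indep M -> #|I| < rk M (ground M) ->
  cl M I \in flats M :\ ground M.
Proof.
move=> iI ltI; have sI := indep_ground iI.
rewrite 2!inE cl_flat // andbT; apply: contraTneq ltI => eI.
by rewrite -leqNgt -eI rk_cl // rk_indep.
Qed.

End MatroidRank.

(** * Tutte polynomials and the convolution formula *)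

Section AlternatingSums.
Local Open Scope ring_scope.

(** Toggling [x] is a sign-reversing involution on the sets that satisfy [P]. *)
Lemma alternating_toggle (V : finType) (x : V) (P : pred {set V}) :
  (forall S : {set V}, x \notin S -> P (x |: S) = P S) ->
  \sum_(S : {set V} | P S) (-1) ^+ #|S| = 0 :> int.
Proof.
move=> hP; rewrite (bigID (fun S : {set V} => x \in S)) /=.
rewrite (reindex_onto (fun S => x |: S) (fun S => S :\ x)) /=; last first.
  by move=> S /andP[_ xS]; rewrite setD1K.
rewrite (eq_bigl (fun S => P S && (x \notin S))); last first.
  move=> S; rewrite setU11 andbT.
  have [xS|xS] := boolP (x \in S); last by rewrite setU1K // eqxx hP.
  rewrite andbF; apply: contraTF xS => /andP[_ /eqP <-].
  by rewrite setD11.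
rewrite -big_split big1 //= => S /andP[_ xS].
by rewrite cardsU1 xS exprS mulN1r addNr.
Qed.

Lemma alternating_interval (V : finType) (A B : {set V}) :
  \sum_(S : {set V} | (A \subset S) && (S \subset B)) (-1) ^+ #|S| =
    (if A == B then (-1) ^+ #|B| else 0) :> int.
Proof.
have [->|neAB] := eqVneq.
  by rewrite (big_pred1 B) // => S; rewrite andbC /= eqEsubset.
have [sAB|sAB] := boolP (A \subset B); last first.
  rewrite big_pred0 // => S; apply: contraNF sAB => /andP[].
  exact: subset_trans.
have [x xB xA] : exists2 x, x \in B & x \notin A.
  by apply/subsetPn; apply: contra neAB => sBA; rewrite eqEsubset sAB.
apply: (alternating_toggle (x := x)) => S xS; rewrite subUset sub1set xB /=.
congr (_ && _); apply/idP/idP => [/subsetP sAS|sAS].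
  apply/subsetP => y yA; have := sAS y yA; rewrite !inE.
  by case: eqP => // eyx; rewrite -eyx yA in xA.
exact: subset_trans sAS (subsetUr _ _).
Qed.

End AlternatingSums.

Section TutteEval.
Local Open Scope ring_scope.
Variables (T : finType) (M : matroid T).
Implicit Types (A B F : {set T}).
Local Notation r := (rk M).
Local Notation E := (ground M).

Lemma tutteE (x y : int) : (tutte M).[x, y] =
  \sum_(A : {set T} | A \subset E)
    (x - 1) ^+ (r E - r A)%N * (y - 1) ^+ (#|A| - r A)%N.
Proof.
rewrite /tutte !horner_sum; apply: eq_bigr => A _.
by rewrite !hornerE.
Qed.

Lemma tutte11 : (tutte M).[1, 1] = #|bases M|%:Z.
Proof.
rewrite tutteE -sum1_card -natz natr_sum big_mkcond [RHS]big_mkcond.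
apply: eq_bigr => A _; rewrite subrr !expr0n !subn_eq0.
have -> : (A \in bases M) = (A \subset E) && (r E <= r A)%N && (#|A| <= r A)%N.
  apply/basesP/idP => [[iA cA]|/andP[/andP[sA rA] cA]].
    by rewrite (indep_ground iA) (rk_indep iA) cA leqnn.
  have cAr : #|A| = r A by apply/eqP; rewrite eqn_leq cA rk_leq_card.
  split; first by rewrite -rk_eq_card // cAr.
  by apply/eqP; rewrite cAr eqn_leq rA rk_ground.
by case: (A \subset E) => //; case: (_ <= _)%N; case: (_ <= _)%N.
Qed.

(** At (0, 1) only sets of nullity 0 contribute, that is, the independent ones; the sign in front
    turns corank into size. Dually, only spanning sets contribute at (1, 0). *)
Lemma tutte01 : (-1) ^+ r E * (tutte M).[0, 1] =
  \sum_(I in indep M) (-1) ^+ #|I| :> int.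
Proof.
rewrite tutteE big_mkcond [RHS]big_mkcond mulr_sumr.
apply: eq_bigr => A _; rewrite subrr sub0r expr0n subn_eq0.
have [sA|sA] := boolP (A \subset E); last first.
  by rewrite mulr0 ifN //; apply: contra sA => /indep_ground.
rewrite -(rk_eq_card sA) eqn_leq rk_leq_card /=.
have [cA|] := boolP (#|A| <= r A)%N; last by rewrite !mulr0.
have -> : #|A| = r A by apply/eqP; rewrite eqn_leq cA rk_leq_card.
by rewrite mulr1 -{1}(subnK (rk_ground M A)) exprD mulrAC -expr2 sqrr_sign mul1r.
Qed.

Lemma tutte10 : (tutte M).[1, 0] =
  (-1) ^+ r E * \sum_(A : {set T} | (A \subset E) && (r A == r E)) (-1) ^+ #|A| :> int.
Proof.
rewrite tutteE big_mkcond [in RHS]big_mkcond mulr_sumr.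
apply: eq_bigr => A _; rewrite subrr sub0r expr0n subn_eq0.
have [sA|sA] /= := boolP (A \subset E); last by rewrite mulr0.
rewrite eqn_leq rk_ground /=.
have [rA|] := boolP (r E <= r A)%N; last by rewrite mul0r mulr0.
have eA : r A = r E by apply/eqP; rewrite eqn_leq rA rk_ground.
rewrite mul1r -eA -{2}(subnK (rk_leq_card M A)) exprD mulrCA -expr2 sqrr_sign mulr1.
by [].
Qed.

End TutteEval.

(** * The convolution formula for the number of bases *)

Section Convolution.
Local Open Scope ring_scope.
Variables (T : finType) (M : matroid T).
Implicit Types (A B C F I : {set T}).
Local Notation r := (rk M).
Local Notation E := (ground M).

Lemma rk_mrestriction F A : A \subset F -> rk (mrestriction M F) A = r A.
Proof.
move=> sAF; apply: eq_bigl => I; rewrite inE -andbA.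
by congr (_ && _); apply/andP/idP => [[]//|sIA]; split=> //; apply: subset_trans sAF.
Qed.

Definition indep_sum A : int := \sum_(I in indep M | I \subset A) (-1) ^+ #|I|.

(** Up to sign this is T(1, 0) of the contraction by [A]. The formula makes sense for every subset,
    which allows a sum over flats to be extended to all subsets. *)
Definition spanning_sum A : int :=
  \sum_(C : {set T} | (A \subset C) && ((C \subset E) && (r C == r E))) (-1) ^+ #|C|.

Lemma tutte_mrestriction F : F \subset E ->
  (-1) ^+ r F * (tutte (mrestriction M F)).[0, 1] = indep_sum F.
Proof.
move=> sF; have := tutte01 (mrestriction M F).
rewrite /= (setIidPr sF) rk_mrestriction // => ->.
by apply: eq_bigl => I; rewrite inE.
Qed.

Lemma tutte_mcontraction F : F \subset E ->
  (tutte (mcontraction M F)).[1, 0] = (-1) ^+ (r E - r F) * (-1) ^+ #|F| * spanning_sum F.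
Proof.
move=> sF; rewrite tutte10 /=.
have rkC A : A \subset E :\: F -> rk (mcontraction M F) A = (r (A :|: F) - r F)%N.
  by move=> sA; rewrite -(rk_mcontraction sA) addnK.
have EF : E :\: F :|: F = E by rewrite setUC setDE setUIr setUCr setIT; apply/setUidPr.
rewrite rkC // EF -mulrA; congr (_ * _).
rewrite /spanning_sum [X in _ * X](reindex_onto (fun A => A :|: F) (fun C => C :\: F));
  last first.
  move=> C /andP[sFC _]; rewrite setUC setDE setUIr setUCr setIT; exact/setUidPr.
rewrite mulr_sumr; apply: eq_big => [A|A /andP[sA _]].
  rewrite subsetUr /= subUset sF andbT.
  have [sA|sA] := boolP (A \subset E :\: F); last first.
    apply/esym; apply: contraNF sA => /andP[/andP[sA _] /eqP <-].
    by rewrite setSD // subUset sA.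
  rewrite (subset_trans sA (subsetDl _ _)) rkC //=.
  have -> : (A :|: F) :\: F == A.
    apply/eqP/setP => y; have := subsetP sA y; rewrite !inE.
    by case: (y \in F); case: (y \in A) => //= ->.
  rewrite andbT -(eqn_add2r (r F)) !subnK ?rk_mono ?subsetUr //.
have dAF : A :&: F = set0.
  apply/setP => y; have := subsetP sA y; rewrite !inE.
  by case: (y \in A) => //= /(_ isT)/andP[/negPf->].
by rewrite cardsU dAF cards0 subn0 addnC exprD mulrA -expr2 sqrr_sign mul1r.
Qed.

(** An element outside [A] that does not raise the rank of [A] raises the rank of no superset, so it
    can be toggled in the spanning sets. *)
Lemma spanning_sum_nonflat A : A \subset E -> A \notin flats M -> spanning_sum A = 0.
Proof.
rewrite inE => sA; rewrite sA /= negb_forall => /existsP[x].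
rewrite negb_imply inE -leqNgt => /andP[/andP[xA xE] rx].
apply: (alternating_toggle (x := x)) => C xC.
rewrite subUset sub1set xE /=.
have -> : (A \subset x |: C) = (A \subset C).
  apply/idP/idP => [/subsetP s|s]; last exact: subset_trans s (subsetUr _ _).
  apply/subsetP => y yA; have := s y yA; rewrite !inE.
  by case: eqP => // eyx; rewrite -eyx yA in xA.
have [sAC|//] := boolP (A \subset C).
have -> : r (x |: C) = r C; last by [].
apply/eqP; rewrite eqn_leq [X in _ && X]rk_mono ?subsetUr // andbT leqNgt.
by apply/negP => /(rk_setU1_gt sAC); rewrite ltnNge rx.
Qed.

Lemma bases_convolution : #|bases M|%:Z =
  \sum_(F in flats M) (tutte (mrestriction M F)).[0, 1] * (tutte (mcontraction M F)).[1, 0].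
Proof.
have e F : F \subset E ->
    (tutte (mrestriction M F)).[0, 1] * (tutte (mcontraction M F)).[1, 0] =
    (-1) ^+ r E * ((-1) ^+ #|F| * indep_sum F * spanning_sum F).
  move=> sF; rewrite -tutte_mrestriction // tutte_mcontraction //.
  rewrite -{2}(subnK (rk_ground M F)) exprD.
  have := sqrr_sign int (r F); rewrite expr2.
  set a := (-1) ^+ r F; set t := (tutte _).[_, _]; set u := spanning_sum F.
  set d := (-1) ^+ (_ - _)%N; set f := (-1) ^+ #|F| => aa.
  transitivity (a * a * (t * (d * f * u))); first by rewrite aa mul1r.
  ring.
rewrite (eq_bigr _ (fun F hF => e F (flat_subset hF))) -mulr_sumr.
(* Nonflats may join the sum, because [spanning_sum] vanishes there. *)
transitivity ((-1) ^+ r E * \sum_(A : {set T} | A \subset E)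
    (-1) ^+ #|A| * indep_sum A * spanning_sum A); last first.
  congr (_ * _); rewrite big_mkcond [RHS]big_mkcond; apply: eq_bigr => A _.
  have [/flat_subset -> //|fA] := boolP (A \in flats M).
  by case: ifP => // sA; rewrite spanning_sum_nonflat ?mulr0.
transitivity ((-1) ^+ r E * \sum_(I in indep M) \sum_(C : {set T} | (C \subset E) && (r C == r E))
    ((-1) ^+ #|I| * (-1) ^+ #|C| *
    \sum_(A : {set T} | (I \subset A) && (A \subset C)) (-1) ^+ #|A| : int)); last first.
  congr (_ * _).
  transitivity (\sum_(A : {set T} | A \subset E) \sum_(I in indep M | I \subset A)
      \sum_(C : {set T} | (A \subset C) && ((C \subset E) && (r C == r E)))
        ((-1) ^+ #|I| * (-1) ^+ #|C| * (-1) ^+ #|A| : int)).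
    rewrite [RHS](exchange_big_dep (mem (indep M))) /=; last by move=> A I _ /andP[].
    apply: eq_bigr => I iI.
    rewrite [RHS](exchange_big_dep (fun C => (C \subset E) && (r C == r E))) /=; last first.
      by move=> A C _ /andP[].
    apply: eq_bigr => C /andP[sC rC]; rewrite mulr_sumr; apply: eq_bigl => A.
    rewrite iI sC rC !andbT /= [RHS]andbC.
    have [sAC|] := boolP (A \subset C); rewrite ?andbF //.
    by rewrite (subset_trans sAC sC) !andbT.
  apply: eq_bigr => A _; rewrite /indep_sum /spanning_sum -mulrA mulr_suml mulr_sumr.
  apply: eq_bigr => I _; rewrite !mulr_sumr.
  by apply: eq_bigr => C _; ring.
(* In the sum over [C] only [C = I] survives; an independent spanning set is a basis, and its four
   signs cancel. *)
rewrite -sum1_card -natz natr_sum mulr_sumr big_mkcond [RHS]big_mkcond.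
apply: eq_bigr => I _; case: ifP => [/basesP[iI cI]|bI]; case: ifP => // iI'.
- rewrite (bigD1 I) /=; last by rewrite (indep_ground iI) rk_indep // cI eqxx.
  rewrite alternating_interval eqxx big1 => [|C /andP[_ /negPf nC]]; last first.
    by rewrite alternating_interval eq_sym nC mulr0.
  rewrite addr0 -cI -!expr2 sqrr_sign mul1r -expr2.
  by rewrite sqrr_sign.
- by rewrite iI in iI'.
- rewrite big1 ?mulr0 // => C /andP[sC /eqP rC]; rewrite alternating_interval.
  case: eqP => [eIC|]; last by rewrite mulr0.
  move/negP: bI => []; apply/basesP; split=> //.
  by rewrite -rC -eIC rk_indep.
Qed.

End Convolution.

(** * Euler characteristics and homology facets *)

Section OrderComplexEuler.
Local Open Scope ring_scope.
Variable T : finType.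
Implicit Types (P C : {set {set T}}) (F G H : {set T}).

Lemma is_chainP C :
  reflect (forall F G, F \in C -> G \in C -> (F \subset G) || (G \subset F)) (is_chain C).
Proof.
apply: (iffP forall_inP) => [h F G FC GC|h F FC].
  by move/forall_inP: (h F FC); apply.
by apply/forall_inP => G GC; apply: h.
Qed.

Lemma chain_cover C : is_chain C -> C != set0 -> cover C \in C.
Proof.
move=> /is_chainP cC /set0Pn[F0 F0C].
case: (arg_maxnP (fun F : {set T} => #|F|) F0C) => F FC maxF.
suff -> : cover C = F by [].
apply/eqP; rewrite eqEsubset [X in _ && X](bigcup_sup F) // andbT.
apply/bigcupsP => G GC; have /orP[//|sFG] := cC G F GC FC.
have geF : (#|G| <= #|F|)%N := maxF G GC.
by rewrite (eqP (_ : F == G)) // eqEcard sFG geF.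
Qed.

Lemma sub_cover C G : G \in C -> G \subset cover C.
Proof. by move=> GC; apply: bigcup_sup. Qed.

(** The empty chain counts +1, so this is minus the reduced Euler characteristic. *)
Definition euler (K : {set {set {set T}}}) : int := \sum_(C in K) (-1) ^+ #|C|.

(** Chains are sorted by their largest member, which is their union. The empty chain has union
    [set0], which marks it only if [set0] is not in [P]. *)
Lemma euler_order_complex P : set0 \notin P ->
  euler (order_complex P) =
    1 - \sum_(G in P) euler (order_complex [set H in P | H \proper G]).
Proof.
move=> P0; have cov0 C : C \in order_complex P -> cover C = set0 -> C = set0.
  rewrite inE => /andP[sC cC] e; apply: contraNeq P0 => /(chain_cover cC).
  by rewrite e => /(subsetP sC).
rewrite /euler (partition_big (@cover T) (mem (set0 |: P))) /=; last first.
  move=> C; rewrite inE => /andP[sC cC]; rewrite !inE.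
  have [->|] := eqVneq C set0; first by rewrite /cover big_set0 eqxx.
  by move=> /(chain_cover cC)/(subsetP sC) ->; rewrite orbT.
rewrite big_setU1 //=; congr (_ + _).
  rewrite (big_pred1 set0) ?cards0 // => C /=.
  apply/andP/eqP => [[CP /eqP /cov0->]|->] //.
  rewrite inE sub0set /cover big_set0 eqxx; split=> //.
  by apply/is_chainP => F G; rewrite inE.
rewrite -sumrN; apply: eq_bigr => G GP.
have G0 : G != set0 by apply: contraNneq P0 => <-.
rewrite (reindex_onto (fun C => G |: C) (fun C => C :\ G)) /=; last first.
  move=> C /andP[+ /eqP eG]; rewrite inE => /andP[_ cC]; rewrite setD1K // -eG.
  apply: chain_cover => //; apply: contraNneq G0 => C0.
  by rewrite -eG C0 /cover big_set0.
rewrite -sumrN; apply: eq_big => [C|C].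
  rewrite !inE; apply/idP/idP => [/andP[/andP[/andP[sC /is_chainP cC] /eqP eG] /eqP eC]|].
    have GC : G \notin C by rewrite -eC setD11.
    apply/andP; split.
      apply/subsetP => H HC; rewrite inE (subsetP sC) ?inE ?HC ?orbT //=.
      rewrite properEneq -{2}eG sub_cover ?inE ?HC ?orbT // andbT.
      by apply: contraNneq GC => <-.
    by apply/is_chainP => F H FC HC; apply: cC; rewrite inE ?FC ?HC orbT.
  move=> /andP[/subsetP sC /is_chainP cC].
  have GC : G \notin C by apply/negP => /sC; rewrite inE properxx andbF.
  have sG F : F \in C -> F \subset G.
    by move=> /sC; rewrite inE => /andP[_ /proper_sub].
  rewrite setU1K // eqxx andbT; apply/andP; split.
    apply/andP; split.
      by apply/subsetP => F; rewrite !inE => /predU1P[->//|/sC]; rewrite inE => /andP[].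
    apply/is_chainP => F H; rewrite !inE => /predU1P[->|FC] /predU1P[->|HC].
    - by rewrite subxx.
    - by rewrite sG ?orbT.
    - by rewrite sG.
    - exact: cC.
  rewrite eqEsubset; apply/andP; split; last by apply: sub_cover; rewrite setU11.
  by apply/bigcupsP => F; rewrite !inE => /predU1P[->|/sG].
move=> /andP[_ /eqP eC]; have GC : G \notin C by rewrite -eC setD11.
by rewrite cardsU1 GC exprS mulN1r.
Qed.

End OrderComplexEuler.

(** * Bergman complexes of loopless matroids and the Moebius function *)

Section BergmanEuler.
Local Open Scope ring_scope.
Variables (T : finType) (M : matroid T).
Implicit Types (A B C F G I : {set T}).
Local Notation r := (rk M).
Local Notation E := (ground M).
Hypothesis loopless : set0 \in flats M.

Definition below F : {set {set T}} :=
  [set H in flats M | (H != set0) && (H \proper F)].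

(** The subsets of a flat are partitioned by their closures, so on flats this satisfies the
    recursion of the Moebius function and equals mu(set0, F). *)
Definition closure_sum F : int :=
  \sum_(A : {set T} | (A \subset E) && (cl M A == F)) (-1) ^+ #|A|.

Lemma cl_set0 : cl M set0 = set0.
Proof. exact: flat_cl. Qed.

Lemma closure_sum0 : closure_sum set0 = 1.
Proof.
rewrite /closure_sum (big_pred1 set0) ?cards0 // => A /=.
apply/andP/eqP => [[sA /eqP e]|->]; last by rewrite sub0set cl_set0.
by apply/eqP; rewrite -subset0 -e cl_sub.
Qed.

Lemma closure_sum_below F : F \in flats M -> F != set0 ->
  closure_sum F = - 1 - \sum_(G in below F) closure_sum G.
Proof.
move=> fF F0; have [x xF] := set0Pn _ F0.
have : \sum_(A : {set T} | (A \subset F)) (-1) ^+ #|A| = 0 :> int.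
  by apply: (alternating_toggle (x := x)) => A xA; rewrite subUset sub1set xF.
rewrite (partition_big (cl M) (mem (F |: (set0 |: below F)))) /=; last first.
  move=> A sA; have sAE := subset_trans sA (flat_subset fF).
  rewrite !in_setU1 [cl M A \in below F]inE (cl_flat sAE) properEneq (cl_min fF sA) andbT /=.
  by case: (cl M A == F) => //; case: (cl M A == set0).
have nF : F \notin set0 |: below F by rewrite !inE negb_or F0 properxx !andbF.
have n0 : set0 \notin below F by rewrite !inE eqxx andbF.
have e G : G \in flats M -> G \subset F ->
    \sum_(A : {set T} | (A \subset F) && (cl M A == G)) (-1) ^+ #|A| = closure_sum G.
  move=> fG sGF; apply: eq_bigl => A; case: eqP => [eG|]; rewrite ?andbF // !andbT.
  have sAF : A \subset F by apply: subset_trans sGF; rewrite -eG cl_sub.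
  by rewrite sAF (subset_trans sAF (flat_subset fF)).
rewrite big_setU1 //= big_setU1 //= !e ?sub0set // closure_sum0.
rewrite (eq_bigr closure_sum) => [h|G]; last first.
  by rewrite inE => /and3P[fG _ /proper_sub sG]; rewrite e.
by move/eqP: h; rewrite addr_eq0 opprD => /eqP.
Qed.

(** Philip Hall's theorem: up to sign, the alternating count of chains strictly between [set0] and
    [F] obeys the same recursion as [closure_sum]. *)
Lemma euler_below F : F \in flats M -> F != set0 ->
  euler (order_complex (below F)) = - closure_sum F.
Proof.
have [k] := ubnP #|F|; elim: k F => // k IHk F; rewrite ltnS => Fk fF F0.
rewrite euler_order_complex; last by rewrite !inE eqxx andbF.
rewrite closure_sum_below // opprB opprK addrC; congr (_ + _).
rewrite -sumrN; apply: eq_bigr => G; rewrite inE => /and3P[fG G0 pG].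
rewrite (_ : [set H in below F | H \proper G] = below G); last first.
  apply/setP => H; rewrite [LHS]inE [H \in below F]inE [RHS]inE -!andbA; do 2 congr (_ && _).
  by rewrite andbA; apply: andb_idl => pH; exact: proper_trans pH pG.
by rewrite IHk ?opprK // (leq_trans (proper_card pG)).
Qed.

Lemma euler_bergman : (0 < r E)%N ->
  (-1) ^+ (r E).-1 * euler (bergman M) = (tutte M).[1, 0].
Proof.
move=> r0; have E0 : E != set0 by apply: contraTneq r0 => ->; rewrite rk0.
have -> : bergman M = order_complex (below E).
  congr order_complex; apply/setP => F.
  rewrite in_setD in_set2 [RHS]inE cl_set0 negb_or properEneq.
  have [fF|] := boolP (F \in flats M); rewrite ?andbF //=.
  by rewrite (flat_subset fF) !andbT.
rewrite euler_below ?ground_flat // tutte10 -[in RHS](prednK r0) exprS mulN1r mulrN mulNr.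
congr (- (_ * _)); apply: eq_bigl => A; have [sA|//] /= := boolP (A \subset E).
rewrite prednK //; apply/eqP/eqP => [e|e]; first by rewrite -(rk_cl sA) e.
by apply: (flat_rk_inj (cl_flat sA)) => //; [exact: cl_ground | rewrite rk_cl // e].
Qed.

End BergmanEuler.

(** * Shellings as partitions of the face poset *)

Section ShellingEuler.
Local Open Scope ring_scope.
Variables (V : finType) (K : {set {set V}}) (lt : rel {set V}).
Hypothesis subK : forall s t : {set V}, t \in K -> s \subset t -> s \in K.

Lemma facet_ex (s : {set V}) : s \in K -> exists2 t, t \in facets K & s \subset t.
Proof.
by move=> sK; have [t /= mt st] := maxset_exists sK; exists t; rewrite ?inE.
Qed.

Lemma facet_in (s : {set V}) : s \in facets K -> s \in K.
Proof. by rewrite inE => /maxsetp. Qed.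

Lemma first_ex (P : pred {set V}) : strict_total_on (facets K) lt ->
  (exists2 t, t \in facets K & P t) ->
  exists t, [/\ t \in facets K, P t &
    forall t', t' \in facets K -> P t' -> t' != t -> lt t t'].
Proof.
move=> [irr tra tot] [t0 t0K Pt0].
pose before t := [set t' in facets K | lt t' t].
have bE t u : (u \in before t) = (u \in facets K) && lt u t by rewrite [LHS]inE.
pose Q t := (t \in facets K) && P t.
have h0 : Q t0 by rewrite /Q t0K.
case: (arg_minnP (fun t => #|before t|) h0) => t /andP[tK Pt] mint.
exists t; split=> // t' t'K Pt' ne.
have /orP[h|//] := tot t' t t'K tK ne.
have /mint : Q t' by rewrite /Q t'K.
rewrite leqNgt => /negP[]; apply: proper_card; apply/properP; split.
  apply/subsetP => u; rewrite !bE => /andP[uK ut']; rewrite uK.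
  exact: tra t' u t t'K uK tK ut' h.
by exists t'; rewrite !bE t'K //= irr.
Qed.

(** The vertices whose removal leaves a face of an earlier facet; a facet is a homology facet
    exactly when this is all of it. *)
Definition restriction_face (t : {set V}) : {set V} :=
  [set x in t | [exists u in facets K, lt u t && (t :\ x \subset u)]].

(** The facet in question is the first one, [t], that contains [s]. For a later [u] in whose
    interval [s] lies, the shelling gives an earlier [w] that meets [u] in all but one vertex [x]
    and contains [t :&: u]. Then [x] is in the restriction of [u], hence in [s] and in [t], hence in
    [w], a contradiction. *)
Lemma shelling_partition (s : {set V}) : shelling K lt -> s \in K ->
  exists t, forall u, (u \in facets K) && ((restriction_face u \subset s) && (s \subset u)) = (u == t).
Proof.
move=> [tot sh] sK; have [irr tra _] := tot.
have [t [tK st mint]] := first_ex tot (facet_ex sK).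
exists t => u; apply/idP/eqP => [/andP[uK /andP[ru su]]|->].
  apply/eqP/negPn/negP => ne; have tu := mint u uK su ne.
  have [w [wK wu sw cw]] := sh t u tK uK tu.
  have [x xu xw] : exists2 x, x \in u & x \notin w.
    apply/subsetPn; apply/negP => /setIidPr e; move: cw; rewrite e => /eqP.
    by rewrite eqn_leq ltnn.
  have ew : w :&: u = u :\ x.
    apply/eqP; rewrite eqEcard; apply/andP; split.
      apply/subsetP => y; rewrite !inE => /andP[yw ->]; rewrite andbT.
      by apply: contraNneq xw => <-.
    by move: cw; rewrite (cardsD1 x u) xu add1n => -[->].
  have /(subsetP ru) xs : x \in restriction_face u.
    rewrite inE xu; apply/exists_inP; exists w => //; rewrite wu /= -ew.
    exact: subsetIl.
  have : x \in t :&: u by rewrite inE xu (subsetP st).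
  by move/(subsetP sw); rewrite inE (negPf xw).
rewrite tK st andbT /=; apply/subsetP => x.
rewrite inE => /andP[xt /exists_inP[w wK /andP[wt sw]]].
apply/negPn/negP => xs.
have sw' : s \subset w.
  apply: subset_trans sw; apply/subsetP => y ys; rewrite !inE (subsetP st) // andbT.
  by apply: contraNneq xs => <-.
have ne : w != t by apply: contraTneq wt => ->; rewrite irr.
by have := tra w t t wK tK tK (mint w wK sw' ne) wt; rewrite irr.
Qed.

Lemma shelling_euler : shelling K lt ->
  \sum_(s in K) (-1) ^+ #|s| = \sum_(s in homology_facets K lt) (-1) ^+ #|s| :> int.
Proof.
move=> sh.
transitivity (\sum_(t in facets K)
    \sum_(s : {set V} | (restriction_face t \subset s) && (s \subset t)) (-1) ^+ #|s| : int).
  rewrite (exchange_big_dep (mem K)) /=; last first.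
    by move=> t s /facet_in tK /andP[_ st]; apply: subK st.
  apply: eq_bigr => s sK; have [t ht] := shelling_partition sh sK.
  by rewrite (big_pred1 t) // => u; rewrite -ht.
rewrite big_mkcond [RHS]big_mkcond; apply: eq_bigr => t _.
rewrite alternating_interval [in RHS]inE; case: ifP => //= tK.
congr (if _ then _ else _); apply/eqP/forall_inP => [e x xt|h].
  by move: (xt); rewrite -{1}e inE => /andP[].
by apply/setP => x; rewrite inE; have [/h ->|] := boolP (x \in t).
Qed.

Lemma shelling_euler_pure d : shelling K lt -> {in facets K, forall s : {set V}, #|s| = d} ->
  (-1) ^+ d * \sum_(s in K) (-1) ^+ #|s| = #|homology_facets K lt|%:Z.
Proof.
move=> sh pu; rewrite shelling_euler // mulr_sumr -sum1_card -natz natr_sum.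
apply: eq_bigr => s; rewrite inE => /andP[sK _].
by rewrite pu // -expr2 sqrr_sign.
Qed.

End ShellingEuler.

(** * Facets of the augmented Bergman complex *)

Section AugFacets.
Variables (T : finType) (M : matroid T).
Implicit Types (A B F G H I : {set T}) (C D : {set {set T}}) (s t u : {set T + {set T}}).
Local Notation r := (rk M).
Local Notation E := (ground M).

Definition flag_above F C : Prop :=
  [/\ C \subset flats M :\ E, is_chain C & forall G, G \in C -> F \subset G].

Lemma flag_above_flat F C G : flag_above F C -> G \in C -> G \in flats M.
Proof. by move=> [sC _ _] /(subsetP sC); rewrite inE => /andP[]. Qed.

Lemma flag_above_rk F C G : flag_above F C -> G \in C -> r G < r E.
Proof.
move=> [sC _ _] /(subsetP sC); rewrite in_setD1 => /andP[nE fG].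
by apply: (flat_rk_proper fG) => //; rewrite properEneq nE flat_subset.
Qed.

Lemma flag_above_sub F C G H : flag_above F C -> G \in C -> H \in C ->
  r G <= r H -> G \subset H.
Proof.
move=> fC GC HC le; have [_ /is_chainP cC _] := fC.
have /orP[//|sHG] := cC G H GC HC.
rewrite (flat_rk_inj (flag_above_flat fC HC) _ sHG le) //.
exact: flat_subset (flag_above_flat fC GC).
Qed.

Lemma flag_above_subset F C D : flag_above F C -> D \subset C -> flag_above F D.
Proof.
move=> [sC /is_chainP cC aC] /subsetP sDC; split.
- exact: subset_trans (introT subsetP sDC) sC.
- by apply/is_chainP => G H /sDC GC /sDC HC; apply: cC.
- by move=> G /sDC/aC.
Qed.

Lemma flag_above_ranks F C : flag_above F C ->
  uniq [seq r G | G <- enum C] /\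
  {subset [seq r G | G <- enum C] <= iota (r F) (r E - r F)}.
Proof.
move=> fC; split.
  rewrite map_inj_in_uniq ?enum_uniq // => G H; rewrite !mem_enum => GC HC e.
  by apply/eqP; rewrite eqEsubset !(flag_above_sub fC) ?e.
move=> k /mapP[G]; rewrite mem_enum => GC ->.
have rG := flag_above_rk fC GC; have [_ _ /(_ G GC) /(rk_mono M) rF] := fC.
by rewrite mem_iota rF subnKC // (leq_trans rF) // ltnW.
Qed.

Lemma flag_above_card F C : flag_above F C -> #|C| + r F <= r E.
Proof.
move=> /flag_above_ranks[un su]; have := uniq_leq_size un su.
rewrite size_map size_iota -cardE => h.
by rewrite -(subnK (rk_ground M F)) leq_add2r.
Qed.

Lemma flag_above_rank_ex F C k : flag_above F C -> #|C| + r F = r E ->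
  r F <= k < r E -> exists2 G, G \in C & r G = k.
Proof.
move=> /flag_above_ranks[un su] cC kF.
have [|_ /(_ k)] := uniq_min_size un su.
  by rewrite size_map size_iota -cardE -cC addnK.
rewrite mem_iota subnKC ?rk_ground // kF => /mapP[G].
by rewrite mem_enum => GC ->; exists G.
Qed.

Lemma flag_above_bottom F C : F \in flats M -> F != E -> flag_above F C ->
  #|C| + r F = r E -> F \in C.
Proof.
move=> fF nE fC cC; have rF : r F < r E.
  by apply: (flat_rk_proper fF) => //; rewrite properEneq nE flat_subset.
have [|G GC rG] := flag_above_rank_ex (k := r F) fC cC; first by rewrite leqnn.
have [_ _ /(_ G GC) sFG] := fC.
by rewrite (flat_rk_inj fF _ sFG) ?rG // flat_subset // (flag_above_flat fC).
Qed.

(** Some rank [k] from [r F] up to [r E - 1] is missed by the flag. A flat of rank [k] fits between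
    the last member [L] of [F |: C] of rank at most [k] and the first member [U] of [E |: C] of rank
    at least [k]. *)
Lemma flag_above_insert F C : F \in flats M -> flag_above F C ->
  #|C| + r F < r E -> exists2 H, H \notin C & flag_above F (H |: C).
Proof.
move=> fF fC ltC; have [un su] := flag_above_ranks fC.
have /hasP[k] : has (fun k => k \notin [seq r G | G <- enum C]) (iota (r F) (r E - r F)).
  rewrite has_predC; apply: contraTN ltC => /allP h.
  have := uniq_leq_size (iota_uniq _ _) h.
  by rewrite size_map size_iota -cardE -leqNgt leq_subLR addnC.
rewrite mem_iota subnKC ?rk_ground // => /andP[Fk kE] kC.
have kC' G : G \in C -> r G != k.
  by move=> GC; apply: contraNneq kC => <-; rewrite map_f // mem_enum.
pose PL G := (G \in F |: C) && (r G <= k).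
have PF : PL F by rewrite /PL setU11.
case: (arg_maxnP (fun G => r G) PF) => L /andP[LC Lk] maxL.
pose PU G := (G \in E |: C) && (k <= r G).
have PE : PU E by rewrite /PU setU11 ltnW.
case: (arg_minnP (fun G => r G) PE) => U /andP[UC kU] minU.
have fCs G : G \in C -> F \subset G by case: fC => _ _; apply.
have fL : L \in flats M by move: LC; rewrite in_setU1 => /predU1P[->|/(flag_above_flat fC)].
have fU : U \in flats M.
  by move: UC; rewrite in_setU1 => /predU1P[->|/(flag_above_flat fC)//]; apply: ground_flat.
have sFL : F \subset L by move: LC; rewrite in_setU1 => /predU1P[->|/fCs].
have sLU : L \subset U.
  move: UC; rewrite in_setU1 => /predU1P[->|UC]; first exact: flat_subset.
  move: LC; rewrite in_setU1 => /predU1P[->|LC]; first exact: fCs.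
  exact: (flag_above_sub fC LC UC (leq_trans Lk kU)).
have [|H [fH sLH sHU rH]] := flat_interpolate (k := k) fL fU sLU; first by rewrite Lk kU.
have HC : H \notin C by apply/negP => /kC'; rewrite rH eqxx.
have cmp G : G \in C -> (G \subset H) || (H \subset G).
  move=> GC; case: (leqP (r G) k) => hk.
    have leL : r G <= r L by apply: maxL; rewrite /PL setU1r.
    rewrite (subset_trans _ sLH) //.
    move: LC; rewrite in_setU1 => /predU1P[eL|LC]; last exact: (flag_above_sub fC).
    rewrite eL in leL *; suff -> : F = G by [].
    by apply: (flat_rk_inj fF) => //; [apply: flat_subset (flag_above_flat fC GC)|apply: fCs].
  have leU : r U <= r G by apply: minU; rewrite /PU setU1r // ltnW.
  apply/orP; right; apply: subset_trans sHU _.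
  move: UC; rewrite in_setU1 => /predU1P[eU|UC]; last exact: (flag_above_sub fC).
  by have := flag_above_rk fC GC; rewrite ltnNge -eU leU.
exists H => //; have [sC /is_chainP cC _] := fC; split.
- rewrite subUset sC sub1set in_setD1 fH !andbT.
  by apply: contraTneq kE => eH; rewrite -leqNgt -rH eH.
- apply/is_chainP => G G'; rewrite !inE => /predU1P[->|GC] /predU1P[->|GC'].
  + by rewrite subxx.
  + by rewrite orbC cmp.
  + exact: cmp.
  + exact: cC.
- move=> G; rewrite !inE => /predU1P[->|/fCs//].
  exact: subset_trans sFL sLH.
Qed.

Definition simplex I C : {set T + {set T}} :=
  [set v | match v with inl i => i \in I | inr F => F \in C end].

Lemma ypart_simplex I C : ypart (simplex I C) = I.
Proof. by apply/setP => i; rewrite !inE. Qed.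

Lemma xpart_simplex I C : xpart (simplex I C) = C.
Proof. by apply/setP => i; rewrite !inE. Qed.

Lemma simplex_parts s : simplex (ypart s) (xpart s) = s.
Proof. by apply/setP => -[i|F]; rewrite !inE. Qed.

Lemma parts_inj s t : ypart s = ypart t -> xpart s = xpart t -> s = t.
Proof. by move=> ey ex; rewrite -(simplex_parts s) ey ex simplex_parts. Qed.

Lemma card_parts s : #|s| = #|ypart s| + #|xpart s|.
Proof.
rewrite -!sum1_card big_mkcond big_sumType /= -!big_mkcond /=.
by congr (_ + _); apply: eq_bigl => v; rewrite inE.
Qed.

Lemma subset_parts s t : (s \subset t) = (ypart s \subset ypart t) && (xpart s \subset xpart t).
Proof.
apply/subsetP/andP => [h|[/subsetP hy /subsetP hx]].
  by split; apply/subsetP => v; rewrite !inE => /h.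
move=> [i|F] vs; first by move: (hy i); rewrite !inE; apply.
by move: (hx F); rewrite !inE; apply.
Qed.

Lemma aug_bergmanP s :
  reflect (ypart s \in indep M /\ flag_above (first_flat M s) (xpart s))
          (s \in aug_bergman M).
Proof.
rewrite inE; apply: (iffP and4P) => [[iy sx cx /forall_inP yx]|[iy [sx cx yx]]].
  split=> //; split=> // G Gx; apply: cl_min (yx G Gx).
  by move/(subsetP sx): Gx; rewrite inE => /andP[].
split=> //; apply/forall_inP => G Gx.
exact: subset_trans (cl_sub _ _) (yx G Gx).
Qed.

Section Indep.
Variable s : {set T + {set T}}.
Hypothesis iy : ypart s \in indep M.

Lemma first_flat_flat : first_flat M s \in flats M.
Proof. exact: cl_flat (indep_ground iy). Qed.

Lemma first_flat_rk : r (first_flat M s) = #|ypart s|.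
Proof. by rewrite rk_cl ?rk_indep // indep_ground. Qed.

Lemma first_flat_sub : ypart s \subset first_flat M s.
Proof. exact: cl_sub. Qed.

End Indep.

Lemma first_flat_simplex I C F : I \in indep M -> F \in flats M -> I \subset F ->
  #|I| = r F -> first_flat M (simplex I C) = F.
Proof. by move=> iI fF sIF cI; rewrite /first_flat ypart_simplex; apply: cl_indep_flat. Qed.

(** Purity: the flag of a simplex with too few vertices misses a rank, so [flag_above_insert]
    enlarges it. *)
Lemma aug_facetP s :
  reflect (s \in aug_bergman M /\ #|ypart s| + #|xpart s| = r E)
          (s \in facets (aug_bergman M)).
Proof.
have le t : t \in aug_bergman M -> #|t| <= r E.
  by move=> /aug_bergmanP[iy /flag_above_card]; rewrite first_flat_rk // card_parts addnC.
rewrite [s \in facets _]inE; apply: (iffP maxsetP) => [[sK mx]|[sK cs]]; split=> //.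
  have [iy fx] := aug_bergmanP _ sK.
  apply/eqP; rewrite eqn_leq -card_parts le //= leqNgt card_parts; apply/negP => lt.
  have [|H HC fH] := flag_above_insert (first_flat_flat iy) fx.
    by rewrite first_flat_rk // addnC.
  have : s \subset simplex (ypart s) (H |: xpart s).
    by rewrite subset_parts ypart_simplex xpart_simplex subxx subsetUr.
  move/(mx _) => e; move: HC; rewrite -(e _) ?xpart_simplex ?setU11 //.
  by apply/aug_bergmanP; rewrite /first_flat ypart_simplex xpart_simplex.
move=> t tK st; apply/esym/eqP; rewrite eqEcard st (card_parts s) cs.
exact: le.
Qed.

Lemma facet_aug s : s \in facets (aug_bergman M) -> s \in aug_bergman M.
Proof. by case/aug_facetP. Qed.

Lemma facet_first_flat s : s \in facets (aug_bergman M) -> first_flat M s != E ->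
  first_flat M s \in xpart s.
Proof.
move=> /aug_facetP[/aug_bergmanP[iy fx] cs] nE.
by apply: flag_above_bottom nE fx _; rewrite ?first_flat_flat // first_flat_rk // addnC.
Qed.

Lemma facet_xpart0 s : s \in facets (aug_bergman M) -> first_flat M s = E ->
  xpart s = set0.
Proof.
move=> /aug_facetP[/aug_bergmanP[iy fx] cs] eE.
apply/eqP; rewrite -cards_eq0; move: cs.
by rewrite -first_flat_rk // eE -[RHS]addn0 => /addnI->.
Qed.

Lemma flag_above0 F : flag_above F set0.
Proof.
by split; rewrite ?sub0set //; [apply/is_chainP => G H|move=> G]; rewrite inE.
Qed.

Lemma basis_facet B : B \in bases M -> simplex B set0 \in facets (aug_bergman M).
Proof.
move=> /basesP[iB cB]; apply/aug_facetP.
rewrite ypart_simplex xpart_simplex cards0 addn0; split=> //.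
apply/aug_bergmanP; rewrite ypart_simplex xpart_simplex; split=> //.
exact: flag_above0.
Qed.

(** The homology facets are the bases. If the first flat is proper, remove its vertex: an earlier
    facet that contains the rest cannot have a larger independent set, so it has the same one, hence
    the same first flat, and is the facet itself. From a basis any [i] can be removed and the
    closure of the rest added as a vertex; every facet containing the result has a smaller
    independent set, so it comes earlier. *)
Lemma flag_to_basis_homology lt : flag_to_basis M lt ->
  #|homology_facets (aug_bergman M) lt| = #|bases M|.
Proof.
move=> [[irr tra _] [sh _ hlt]].
suff -> : homology_facets (aug_bergman M) lt = [set simplex B set0 | B in bases M].
  by apply: card_in_imset => B B' _ _ /(congr1 (@ypart T)); rewrite !ypart_simplex.
apply/setP => s; rewrite inE; apply/andP/imsetP => [[sK /forall_inP hs]|[B BM ->]].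
  have /aug_facetP[sA cs] := sK; have [iy _] := aug_bergmanP _ sA.
  have eE : first_flat M s = E.
    apply/eqP/negPn/negP => nE.
    have Fx := facet_first_flat sK nE.
    have [|t tK /andP[ts st]] := exists_inP (hs (inr (first_flat M s)) _).
      by move: Fx; rewrite inE.
    have /aug_facetP[tA ct] := tK; have [iyt _] := aug_bergmanP _ tA.
    have nst : ~~ lt s t by apply/negP => h; have := tra t s s tK sK sK h ts; rewrite irr.
    have sy : ypart s \subset ypart t.
      by apply/subsetP => i; rewrite !inE => si; apply: (subsetP st); rewrite !inE.
    have ey : ypart s = ypart t.
      apply/eqP; rewrite eqEcard sy leqNgt; apply/negP => h.
      by move/negP: nst; apply; apply: hlt => //; left.
    have ef : first_flat M t = first_flat M s by rewrite /first_flat ey.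
    have sx : xpart s \subset xpart t.
      apply/subsetP => G Gs; have [->|ne] := eqVneq G (first_flat M s).
        by rewrite -ef; apply: facet_first_flat; rewrite ?ef.
      move: Gs; rewrite !inE => Gs; apply: (subsetP st); rewrite !inE Gs andbT.
      by apply: contra_neq ne => -[].
    have ets : s = t.
      by apply/eqP; rewrite eqEcard subset_parts ey subxx sx !card_parts ct cs leqnn.
    by move: ts; rewrite -ets irr.
  exists (ypart s).
    apply/basesP; split=> //; have := first_flat_rk iy; rewrite eE => <- //.
  by rewrite -{1}(simplex_parts s) (facet_xpart0 sK eE).
split; first exact: basis_facet.
apply/forall_inP => -[i|G]; rewrite !inE // => iB; apply/exists_inP.
have [iBM cB] := basesP _ _ BM.
have iBi : B :\ i \in indep M by apply: indep_sub iBM (subsetDl _ _).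
have ltB : #|B :\ i| < r E by rewrite -cB (cardsD1 i B) iB.
have fG := indep_sub_proper_flat iBi ltB; set G := cl M _ in fG.
have [|t tK st] := facet_ex (K := aug_bergman M) (s := simplex (B :\ i) [set G]).
  apply/aug_bergmanP; rewrite /first_flat ypart_simplex xpart_simplex; split=> //; split.
  - by rewrite sub1set.
  - by apply/is_chainP => F H; rewrite !inE => /eqP-> /eqP->; rewrite subxx.
  - by move=> F; rewrite inE => /eqP->.
have [iyt [_ _ fxt]] := aug_bergmanP _ (facet_aug tK).
move: st; rewrite subset_parts ypart_simplex xpart_simplex sub1set => /andP[sy Gt].
exists t => //; apply/andP; split.
  apply: hlt => //; first exact: basis_facet.
  left; rewrite ypart_simplex cB; apply: leq_ltn_trans ltB.
  rewrite -first_flat_rk //; apply: leq_trans (rk_mono M (fxt G Gt)) _.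
  by rewrite rk_cl ?rk_indep // indep_ground.
apply/subsetP => -[j|F]; rewrite !inE // => /andP[ne jB].
have : j \in ypart t by apply: (subsetP sy); rewrite !inE jB andbT; apply: contra_neq ne => ->.
by rewrite inE.
Qed.

End AugFacets.

(** * Flags above a flat and the Bergman complex of the contraction *)

Section ContractionFlags.
Variables (T : finType) (M : matroid T) (F : {set T}).
Hypotheses (fF : F \in flats M) (nE : F != ground M).
Implicit Types (A B G H I : {set T}) (C D : {set {set T}}).
Local Notation r := (rk M).
Local Notation E := (ground M).
Local Notation N := (mcontraction M F).

(** [shrink] and [thicken] translate between flags of [M] strictly above [F] and simplices of the
    Bergman complex of the contraction. *)
Definition shrink C : {set {set T}} := [set G :\: F | G in C].
Definition thicken D : {set {set T}} := [set A :|: F | A in D].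

Lemma setDUK G : F \subset G -> (G :\: F) :|: F = G.
Proof. by move=> s; rewrite setUC setDE setUIr setUCr setIT; apply/setUidPr. Qed.

Lemma setD_inj G H : F \subset G -> F \subset H -> G :\: F = H :\: F -> G = H.
Proof. by move=> sG sH e; rewrite -(setDUK sG) e setDUK. Qed.

Lemma sub_ground : F \subset E. Proof. exact: flat_subset. Qed.

Lemma rk_lt_ground : r F < r E.
Proof. by apply: (flat_rk_proper fF) => //; rewrite properEneq nE sub_ground. Qed.

Lemma contraction_loopless : set0 \in flats N.
Proof.
rewrite flats_mcontraction ?sub_ground //; apply/imsetP; exists F.
  by rewrite inE fF subxx.
by rewrite setDv.
Qed.

Lemma contraction_rk : rk N (ground N) = r E - r F.
Proof.
apply/eqP; rewrite -(eqn_add2r (r F)) rk_mcontraction // subnK ?rk_ground //.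
by rewrite setDUK ?sub_ground.
Qed.

Lemma bergman_contraction A :
  (A \in flats N :\: [set cl N set0; ground N]) =
  [exists G in flats M :\ E, [&& F \subset G, G != F & A == G :\: F]].
Proof.
rewrite in_setD in_set2 cl_set0 ?contraction_loopless //.
rewrite flats_mcontraction ?sub_ground // negb_or /=.
apply/idP/exists_inP.
  move=> /andP[/andP[A0 AE] /imsetP[G]]; rewrite inE => /andP[fG sG] eA.
  exists G.
    by rewrite in_setD1 fG andbT; apply: contraNneq AE => e; rewrite eA e.
  rewrite sG eA eqxx andbT /=; apply: contraNneq A0 => e.
  by rewrite eA e setDv.
move=> [G]; rewrite in_setD1 => /andP[GE fG] /and3P[sG GF /eqP ->].
apply/andP; split; last by apply/imsetP; exists G; rewrite // inE fG.
apply/andP; split.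
  apply: contra_neq GF => e; apply: (setD_inj sG) => //.
  by rewrite setDv.
by apply: contra_neq GE => e; apply: (setD_inj sG) => //; exact: sub_ground.
Qed.

Lemma bergman_disjoint D A : D \in bergman N -> A \in D -> [disjoint A & F].
Proof.
rewrite inE => /andP[/subsetP sD _] /sD; rewrite bergman_contraction.
move=> /exists_inP[G _ /and3P[_ _ /eqP->]].
by rewrite disjoint_sym disjoints_subset setDE setCI setCK subsetUr.
Qed.

Lemma shrink_bergman C : flag_above M F C -> F \notin C -> shrink C \in bergman N.
Proof.
move=> [sC /is_chainP cC aC] FC; rewrite inE; apply/andP; split.
  apply/subsetP => A /imsetP[G GC ->]; rewrite bergman_contraction.
  apply/exists_inP; exists G; first exact: (subsetP sC).
  by rewrite aC // eqxx andbT /=; apply: contraNneq FC => <-.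
apply/is_chainP => A B /imsetP[G GC ->] /imsetP[H HC ->].
by apply/orP; case/orP: (cC G H GC HC) => h; [left | right]; exact: setSD.
Qed.

Lemma thicken_flag D : D \in bergman N ->
  [/\ flag_above M F (thicken D), F \notin thicken D & shrink (thicken D) = D].
Proof.
move=> DN; have dD A := @bergman_disjoint D A DN.
move: (DN); rewrite inE => /andP[/subsetP sD /is_chainP cD].
have hD A : A \in D -> exists G, [/\ G \in flats M :\ E, F \subset G, G != F & A = G :\: F].
  by move=> /sD; rewrite bergman_contraction => /exists_inP[G h /and3P[? ? /eqP?]]; exists G.
have hU G : G \in thicken D -> [/\ G \in flats M :\ E, F \subset G, G != F & G :\: F \in D].
  move=> /imsetP[A AD ->]; have [H [fH sH nH eA]] := hD A AD.
  by move: AD; rewrite eA setDUK.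
split.
- split.
  + by apply/subsetP => G /hU[].
  + apply/is_chainP => G H /hU[_ sG _ GD] /hU[_ sH _ HD].
    rewrite -(setDUK sG) -(setDUK sH).
    by apply/orP; case/orP: (cD _ _ GD HD) => h; [left | right]; exact: setSU.
  + by move=> G /hU[].
- by apply/negP => /hU[_ _]; rewrite eqxx.
- apply/setP => A; apply/imsetP/idP => [[G /hU[_ _ _ GD] ->] //|AD].
  exists (A :|: F); first by apply/imsetP; exists A.
  by have /setDidPl e := dD A AD; rewrite setDUl setDv setU0 e.
Qed.

Lemma card_shrink C : flag_above M F C -> #|shrink C| = #|C|.
Proof.
move=> [_ _ aC]; apply: card_in_imset => G H GC HC; apply: setD_inj; exact: aC.
Qed.

Lemma shrink_inj C D : flag_above M F C -> flag_above M F D ->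
  shrink C = shrink D -> C = D.
Proof.
have half C' D' : flag_above M F C' -> flag_above M F D' -> shrink C' = shrink D' -> C' \subset D'.
  move=> [_ _ aC] [_ _ aD] e; apply/subsetP => G GC.
  have : G :\: F \in shrink D' by rewrite -e; apply/imsetP; exists G.
  by move=> /imsetP[H HD /(setD_inj (aC G GC) (aD H HD)) ->].
by move=> fC fD e; apply/eqP; rewrite eqEsubset !half.
Qed.

Lemma flag_above_bottomU C : flag_above M F C -> flag_above M F (F |: C).
Proof.
move=> [sC /is_chainP cC aC]; split.
- by rewrite subUset sC sub1set in_setD1 nE fF.
- apply/is_chainP => G H; rewrite !in_setU1 => /predU1P[->|GC] /predU1P[->|HC].
  + by rewrite subxx.
  + by rewrite aC.
  + by rewrite (aC G) ?orbT.
  + exact: cC.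
- by move=> G; rewrite in_setU1 => /predU1P[->|/aC].
Qed.

Lemma bergman_card D : D \in bergman N -> #|D| < r E - r F.
Proof.
move=> /thicken_flag[fD FD eD]; have fU := flag_above_bottomU fD.
have := flag_above_card fU; rewrite cardsU1 FD -card_shrink // eD.
by rewrite add1n => h; rewrite ltn_subRL addnC.
Qed.

(** A maximal flag above [F] meets every rank from [r F] to [r E - 1]; the first of these belongs to
    [F] itself, whence the predecessor. *)
Lemma bergman_facetP D :
  reflect (D \in bergman N /\ #|D| = (r E - r F).-1) (D \in facets (bergman N)).
Proof.
rewrite [D \in facets _]inE; apply: (iffP maxsetP) => [[DN mx]|[DN cD]]; split=> //.
  have cD := bergman_card DN; have [fD FD eD] := thicken_flag DN.
  have fU := flag_above_bottomU fD.
  apply/eqP; rewrite eqn_leq -ltnS prednK ?subn_gt0 ?rk_lt_ground // cD /=.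
  rewrite leqNgt; apply/negP => lt.
  have [|H HU fH] := flag_above_insert fF fU.
    rewrite cardsU1 FD -card_shrink // eD add1n addnC -ltn_subRL.
    by move: lt; case: (_ - _).
  move: HU; rewrite in_setU1 negb_or => /andP[HF HD].
  have fHD : flag_above M F (H |: thicken D).
    by apply: flag_above_subset fH _; rewrite setUCA subsetUr.
  have FHD : F \notin H |: thicken D by rewrite in_setU1 negb_or eq_sym HF.
  have sub : D \subset shrink (H |: thicken D).
    by rewrite -{1}eD; apply: imsetS; exact: subsetUr.
  have e := mx _ (shrink_bergman fHD FHD) sub.
  have cD' : #|D| = #|thicken D| by rewrite -{1}eD card_shrink.
  have := card_shrink fHD; rewrite cardsU1 HD e cD' add1n => /eqP.
  by rewrite eqn_leq ltnn andbF.
move=> D' D'N sD; apply/esym/eqP; rewrite eqEcard sD cD.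
by rewrite -ltnS prednK ?subn_gt0 ?rk_lt_ground // bergman_card.
Qed.

Lemma bergman_sub C D : D \in bergman N -> C \subset D -> C \in bergman N.
Proof.
rewrite !inE => /andP[sD /is_chainP cD] sC; rewrite (subset_trans sC sD).
by apply/is_chainP => A B /(subsetP sC) AD /(subsetP sC); apply: cD.
Qed.

Lemma bergman_homology_card lt : shelling (bergman N) lt ->
  (#|homology_facets (bergman N) lt|%:Z = (tutte N).[1, 0])%R.
Proof.
move=> sh; rewrite -(shelling_euler_pure (d := (r E - r F).-1) _ sh).
- rewrite -contraction_rk -euler_bergman ?contraction_loopless //.
  by rewrite contraction_rk subn_gt0 rk_lt_ground.
- by move=> C D; exact: bergman_sub.
- by move=> D /bergman_facetP[].
Qed.

End ContractionFlags.

(** * Independence complexes of restrictions *)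

Section RestrictionHomology.
Variables (T : finType) (M : matroid T) (F : {set T}).
Hypothesis fF : F \in flats M.

Lemma restriction_facetP I :
  reflect [/\ I \in indep M, I \subset F & #|I| = rk M F]
          (I \in facets (indep (mrestriction M F))).
Proof.
have sF := flat_subset fF.
have -> : facets (indep (mrestriction M F)) = bases (mrestriction M F) by [].
apply: (iffP (basesP _ _)); rewrite inE rk_mrestriction /= ?(setIidPr sF) //.
  by move=> [/andP[]].
by move=> [-> ->].
Qed.

Lemma restriction_homology_card lt : shelling (indep (mrestriction M F)) lt ->
  (#|homology_facets (indep (mrestriction M F)) lt|%:Z =
    (tutte (mrestriction M F)).[0, 1])%R.
Proof.
move=> sh; rewrite -(shelling_euler_pure (d := rk M F) _ sh).
- have := tutte01 (mrestriction M F).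
  rewrite rk_mrestriction /= ?(setIidPr (flat_subset fF)) // => <-.
  by rewrite mulrA -expr2 sqrr_sign mul1r.
- by move=> s t; exact: indep_sub.
- by move=> I /restriction_facetP[].
Qed.

End RestrictionHomology.

(** * Homology facets of basis-to-flag orderings *)

Section BasisToFlag.
Variables (T : finType) (M : matroid T) (lt : rel {set T + {set T}}).
Variables (shB : {set T} -> rel {set {set T}}) (shI : {set T} -> rel {set T}).
Local Notation r := (rk M).
Local Notation E := (ground M).
Local Notation K := (aug_bergman M).
Local Notation homI F := (homology_facets (indep (mrestriction M F)) (shI F)).
Local Notation homB F := (homology_facets (bergman (mcontraction M F)) (shB F)).
Hypotheses (tot : strict_total_on (facets K) lt)
  (hB : bergman_shellings M shB) (hI : indep_shellings M shI).
Hypothesis hlt : {in facets K &, forall s t,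
  [\/ #|ypart t| < #|ypart s|,
      [/\ first_flat M s = first_flat M t, first_flat M s != E &
          shB (first_flat M s) (flag M s) (flag M t)] |
      xpart s = xpart t /\ shI (first_flat M s) (ypart s) (ypart t)] -> lt s t}.
Implicit Types (s t : {set T + {set T}}) (F G H I : {set T}).

Lemma lt_asym s t : s \in facets K -> t \in facets K -> lt s t -> lt t s -> False.
Proof.
case: tot => irr tra _ sK tK st ts.
by have := tra t s s tK sK sK st ts; rewrite irr.
Qed.

Lemma lt_neq s t : s \in facets K -> lt t s -> t != s.
Proof. by case: tot => irr _ _ sK; apply: contraTneq => ->; rewrite irr. Qed.

Lemma facet_ypart s : s \in facets K ->
  ypart s \in facets (indep (mrestriction M (first_flat M s))).
Proof.
move=> /facet_aug/aug_bergmanP[iy _].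
apply/restriction_facetP; first exact: first_flat_flat.
by split=> //; [exact: first_flat_sub | rewrite first_flat_rk].
Qed.

Lemma flagE s : flag M s = shrink (first_flat M s) (xpart s :\ first_flat M s).
Proof. by []. Qed.

Lemma facet_flag s : s \in facets K -> first_flat M s != E ->
  flag M s \in facets (bergman (mcontraction M (first_flat M s))).
Proof.
move=> sK nE; have /aug_facetP[/aug_bergmanP[iy fx] cs] := sK.
have fD := flag_above_subset fx (subsetDl _ [set first_flat M s]).
apply/(bergman_facetP (first_flat_flat iy) nE); rewrite flagE; split.
  by apply: shrink_bergman; rewrite ?first_flat_flat // setD11.
rewrite (card_shrink fD) first_flat_rk // -cs addKn.
by rewrite (cardsD1 (first_flat M s) (xpart s)) facet_first_flat.
Qed.

Lemma simplex_facet I F (C : {set {set T}}) : F \in flats M -> I \in indep M -> I \subset F ->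
  #|I| = r F -> flag_above M F C -> #|C| + r F = r E ->
  simplex I C \in facets K /\ first_flat M (simplex I C) = F.
Proof.
move=> fF iI sIF cI fC cC; have e : first_flat M (simplex I C) = F.
  exact: first_flat_simplex.
split=> //; apply/aug_facetP; rewrite ypart_simplex xpart_simplex cI addnC cC.
by split=> //; apply/aug_bergmanP; rewrite e ypart_simplex xpart_simplex.
Qed.

Lemma same_ypart s t : s \in facets K -> t \in facets K ->
  ypart s \subset ypart t -> ypart t \subset first_flat M s -> ypart t = ypart s.
Proof.
move=> /facet_aug/aug_bergmanP[iy _] /facet_aug/aug_bergmanP[iyt _] st tF.
by apply/esym/eqP; rewrite eqEcard st -(first_flat_rk iy) rk_geq.
Qed.

Lemma ypart_sub_first s t : s \in facets K -> t \in facets K ->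
  (first_flat M s != E -> first_flat M s \in xpart t) -> ypart t \subset first_flat M s.
Proof.
move=> sK /facet_aug/aug_bergmanP[iy [_ _ fx]] h.
have [->|/h Ft] := eqVneq (first_flat M s) E; first exact: indep_ground.
exact: subset_trans (first_flat_sub _ _) (fx _ Ft).
Qed.

(** After removal of [y_i], an earlier facet [t] keeps the whole flag, so its independent set lies
    in the first flat and is not larger. It is not smaller either, since larger sets come first.
    Thus [t] has the same flag, and the comparison takes place in the shelling of the
    restriction. *)
Lemma homology_ypart s : s \in homology_facets K lt ->
  ypart s \in homI (first_flat M s).
Proof.
rewrite inE => /andP[sK /forall_inP hs]; have /aug_facetP[/aug_bergmanP[iy fx] cs] := sK.
rewrite inE facet_ypart //=; apply/forall_inP => i iys.
have [|t tK /andP[ts st]] := exists_inP (hs (inl i) _); first by rewrite inE in iys.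
have /aug_facetP[/aug_bergmanP[iyt fxt] ct] := tK.
have sx : xpart s \subset xpart t.
  by apply/subsetP => G; rewrite !inE => Gs; apply: (subsetP st); rewrite !inE.
have tF : ypart t \subset first_flat M s.
  by apply: ypart_sub_first => // /(facet_first_flat sK)/(subsetP sx).
have cy : #|ypart t| = #|ypart s|.
  apply/eqP; rewrite eqn_leq -{1}(first_flat_rk iy) rk_geq //= leqNgt.
  by apply/negP => h; apply: (lt_asym sK tK _ ts); apply: hlt => //; constructor 1.
have ex : xpart t = xpart s.
  apply/esym/eqP; rewrite eqEcard sx -(leq_add2l #|ypart t|) ct -cs cy.
  exact: leqnn.
have fts : first_flat M t = first_flat M s.
  by apply: cl_indep_flat; rewrite ?first_flat_flat // first_flat_rk.
have ne : ypart t != ypart s.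
  by apply: contraNneq (lt_neq sK ts) => ey; apply/eqP/parts_inj.
apply/exists_inP; exists (ypart t); first by rewrite -fts facet_ypart.
have [_ _ totI] := (hI (first_flat_flat iy)).1.
have ytF : ypart t \in facets (indep (mrestriction M (first_flat M s))).
  by rewrite -fts facet_ypart.
have /orP[->|h] := totI _ _ ytF (facet_ypart sK) ne; last first.
  by case: (lt_asym sK tK _ ts); apply: hlt => //; constructor 3.
apply/subsetP => j; rewrite !inE => /andP[ji js]; apply: (subsetP st).
by rewrite !inE js andbT; apply: contra_neq ji => -[].
Qed.

(** After removal of a flat other than the first, an earlier facet still contains the first flat.
    This bounds the size of its independent set, which is therefore unchanged, and the comparison
    takes place in the shelling of the contraction. *)
Lemma homology_flag s : s \in homology_facets K lt -> first_flat M s != E ->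
  flag M s \in homB (first_flat M s).
Proof.
rewrite inE => /andP[sK /forall_inP hs] nE; have /aug_facetP[/aug_bergmanP[iy fx] cs] := sK.
rewrite inE facet_flag //=; apply/forall_inP => A /imsetP[G].
rewrite in_setD1 => /andP[GF Gs] ->.
have [|t tK /andP[ts st]] := exists_inP (hs (inr G) _); first by rewrite inE in Gs.
have sy : ypart s \subset ypart t.
  by apply/subsetP => i; rewrite !inE => si; apply: (subsetP st); rewrite !inE.
have sx H : H \in xpart s -> H != G -> H \in xpart t.
  rewrite !inE => Hs HG; apply: (subsetP st); rewrite !inE Hs andbT.
  by apply: contra_neq HG => -[].
have Ft : first_flat M s \in xpart t by apply: sx; rewrite ?facet_first_flat // eq_sym.
have ey : ypart t = ypart s by apply: same_ypart => //; apply: ypart_sub_first.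
have fts : first_flat M t = first_flat M s by rewrite /first_flat ey.
have /aug_facetP[/aug_bergmanP[iyt fxt] ct] := tK.
have tB : flag M t \in facets (bergman (mcontraction M (first_flat M s))).
  by rewrite -fts facet_flag // fts.
have ne : flag M t != flag M s.
  apply: contraNneq (lt_neq sK ts) => e; apply/eqP/parts_inj => //.
  rewrite -(setD1K Ft) -(setD1K (facet_first_flat sK nE)); congr (_ |: _).
  apply: (shrink_inj (M := M) (F := first_flat M s)).
  - by apply: flag_above_subset (subsetDl _ _); rewrite -fts.
  - exact: flag_above_subset fx (subsetDl _ _).
  - by rewrite -flagE -e flagE fts.
apply/exists_inP; exists (flag M t) => //.
have [_ _ totB] := (hB (first_flat_flat iy) nE).1.
have /orP[->|h] := totB _ _ tB (facet_flag sK nE) ne; last first.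
  by case: (lt_asym sK tK _ ts); apply: hlt => //; constructor 2.
apply/subsetP => A'; rewrite in_setD1 => /andP[AG /imsetP[H]].
rewrite in_setD1 => /andP[HF Hs] eA; rewrite eA in AG *.
have HG : H != G by apply: contraNneq AG => ->.
by apply/imsetP; exists H; rewrite fts // in_setD1 HF sx.
Qed.

Lemma ypart_homology s i : s \in facets K ->
  ypart s \in homI (first_flat M s) ->
  i \in ypart s -> exists2 t, t \in facets K & lt t s && (s :\ inl i \subset t).
Proof.
move=> sK; have /aug_facetP[/aug_bergmanP[iy fx] cs] := sK.
rewrite inE => /andP[_ /forall_inP hI'] iys.
have [I' /(restriction_facetP (first_flat_flat iy))[iI sI cI] /andP[lI sub]] :=
  exists_inP (hI' i iys).
have [|tK ft] := simplex_facet (first_flat_flat iy) iI sI cI fx.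
  by rewrite first_flat_rk // addnC.
exists (simplex I' (xpart s)) => //; apply/andP; split.
  by apply: hlt => //; constructor 3; rewrite ft ypart_simplex xpart_simplex.
apply/subsetP => -[j|G]; rewrite !inE //= => /andP[ji js]; apply: (subsetP sub).
by rewrite !inE js andbT; apply: contra_neq ji => ->.
Qed.

Lemma flag_homology s G : s \in facets K -> first_flat M s != E ->
  flag M s \in homB (first_flat M s) ->
  G \in xpart s -> G != first_flat M s ->
  exists2 t, t \in facets K & lt t s && (s :\ inr G \subset t).
Proof.
move=> sK nE; have /aug_facetP[/aug_bergmanP[iy fx] cs] := sK.
have fF := first_flat_flat iy; set F := first_flat M s in nE fx fF *.
rewrite inE => /andP[_ /forall_inP hB'] Gs GF.
have Gf : G :\: F \in flag M s by apply/imsetP; exists G; rewrite // in_setD1 GF.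
have [D' /(bergman_facetP fF nE)[DN cD] /andP[lD sub]] := exists_inP (hB' _ Gf).
have [fD FD eD] := thicken_flag fF DN.
have sIF : ypart s \subset F by exact: first_flat_sub.
have cI : #|ypart s| = r F by rewrite first_flat_rk.
have [|tK ft] := simplex_facet fF iy sIF cI (flag_above_bottomU fF nE fD).
  rewrite cardsU1 FD -(card_shrink fD) eD cD add1n prednK ?subn_gt0 ?rk_lt_ground //.
  by rewrite subnK ?rk_ground.
exists (simplex (ypart s) (F |: thicken F D')) => //; apply/andP; split.
  apply: hlt => //; constructor 2; rewrite ft; split=> //.
  by rewrite flagE ft xpart_simplex setU1K // eD.
apply/subsetP => -[i|H]; rewrite !inE //= => /andP[HG Hs].
have [//|HF] := eqVneq H F; have [_ _ aF] := fx.
have Hx : H \in xpart s by rewrite inE.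
apply/imsetP; exists (H :\: F); last by rewrite setDUK // aF.
apply: (subsetP sub); rewrite in_setD1; apply/andP; split.
  by apply: contra_neq HG => e; congr inr; apply: (setD_inj (aF H Hx) (aF G Gs) e).
by apply/imsetP; exists H; rewrite // in_setD1 HF.
Qed.

(* Dropping the vertex of the first flat leaves room to enlarge the independent
   set, and facets with larger independent sets come first. *)
Lemma first_flat_homology s : s \in facets K -> first_flat M s != E ->
  exists2 t, t \in facets K & lt t s && (s :\ inr (first_flat M s) \subset t).
Proof.
move=> sK nE; have /aug_facetP[/aug_bergmanP[iy fx] cs] := sK.
have fF := first_flat_flat iy; set F := first_flat M s in nE fx fF *.
set C := xpart s :\ F; have fC : flag_above M F C := flag_above_subset fx (subsetDl _ _).
(* The next member of the flag above [F], or [E] if there is none, contains an element [x] outside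
   [F]; it lies in all later members too, so [x] can join the independent set. *)
pose P G := G \in E |: C.
have PE : P E by rewrite /P setU11.
case: (arg_minnP (fun G : {set T} => #|G|) PE) => G0; rewrite /P in_setU1 => G0C minG.
have sFG : F \proper G0.
  case/predU1P: G0C => [->|G0C]; first by rewrite properEneq nE flat_subset.
  have [_ _ aC] := fC; rewrite properEneq aC // andbT eq_sym.
  by move: G0C; rewrite in_setD1 => /andP[].
have [_ [x xG xF]] := properP sFG.
have xE : x \in E.
  case/predU1P: G0C => [<-//|G0C].
  exact: (subsetP (flat_subset (flag_above_flat fC G0C))).
have xC G : G \in C -> x \in G.
  move=> GC; apply: (subsetP _ x xG).
  case/predU1P: G0C => [eG|G0C].
    have leG : #|G0| <= #|G| by apply: minG; rewrite /P setU1r.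
    rewrite (_ : G0 = G) //; apply/esym/eqP; rewrite eqEcard leG andbT eG.
    exact: flat_subset (flag_above_flat fC GC).
  have leG : #|G0| <= #|G| by apply: minG; rewrite /P setU1r.
  have [_ /is_chainP cC _] := fC; have /orP[//|sG] := cC G0 G G0C GC.
  by rewrite (_ : G0 = G) //; apply/esym/eqP; rewrite eqEcard leG sG.
have sIF : ypart s \subset F by exact: first_flat_sub.
have xI : x \notin ypart s by apply: contra xF => /(subsetP sIF).
have ixI : x |: ypart s \in indep M.
  rewrite -rk_eq_card ?subUset ?sub1set ?xE ?indep_ground // eqn_leq rk_leq_card /=.
  rewrite cardsU1 xI add1n -(rk_indep iy).
  exact: rk_setU1_gt sIF (flat_rk_lt fF xE xF).
have [|t tK st] := facet_ex (K := K) (s := simplex (x |: ypart s) C).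
  apply/aug_bergmanP; rewrite ypart_simplex xpart_simplex; split=> //.
  have [sC cC aC] := fC; split=> // G GC; rewrite /first_flat ypart_simplex.
  apply: cl_min; first exact: flag_above_flat fC GC.
  by rewrite subUset sub1set xC // (subset_trans sIF) // aC.
exists t => //; move: st; rewrite subset_parts ypart_simplex xpart_simplex => /andP[sy sx].
apply/andP; split.
  apply: hlt => //; constructor 1; apply: leq_trans (subset_leq_card sy).
  by rewrite cardsU1 xI.
apply/subsetP => -[i|G]; rewrite !inE // => /andP[ne h].
  by have := subsetP sy i; rewrite !inE h orbT; apply.
have := subsetP sx G; rewrite !inE h andbT; apply.
by apply: contra_neq ne => ->.
Qed.

(** The vertex of the first flat imposes no condition, by [first_flat_homology]; a basis has an
    empty flag, whence the disjunct [first_flat M s == E]. *)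
Lemma homology_facetE s : s \in facets K ->
  (s \in homology_facets K lt) =
  (ypart s \in homI (first_flat M s)) &&
  ((first_flat M s == E) ||
   (flag M s \in homB (first_flat M s))).
Proof.
move=> sK; apply/idP/andP => [hs|[hy hf]].
  rewrite homology_ypart //; split=> //.
  by have [//|nE] := eqVneq; apply: homology_flag.
rewrite inE sK; apply/forall_inP => -[i|G] vs; apply/exists_inP.
  by apply: ypart_homology => //; rewrite inE.
have Gx : G \in xpart s by rewrite inE.
have nE : first_flat M s != E.
  apply/eqP => /(facet_xpart0 sK) e; by rewrite e inE in Gx.
have [->|GF] := eqVneq G (first_flat M s); first exact: first_flat_homology.
apply: flag_homology => //.
by move: hf; rewrite (negPf nE).
Qed.

Lemma homology_facet_in s : s \in homology_facets K lt -> s \in facets K.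
Proof. by rewrite inE => /andP[]. Qed.

(** This factor 1 at [F = E] matches the absent flag of a basis. *)
Lemma tutte_mcontraction_ground : ((tutte (mcontraction M E)).[1, 0] = 1)%R.
Proof.
rewrite tutte_mcontraction // subnn expr0 mul1r /spanning_sum.
rewrite (big_pred1 E) => [|C /=]; first by rewrite -expr2 sqrr_sign.
rewrite andbA -eqEsubset eq_sym; apply: andb_idr => /eqP ->.
exact: eqxx.
Qed.

Lemma basis_to_flag_count F : F \in flats M ->
  (#|[set s in homology_facets K lt | first_flat M s == F]|%:Z =
    (tutte (mrestriction M F)).[0, 1] * (tutte (mcontraction M F)).[1, 0])%R.
Proof.
move=> fF; set S := [set s in _ | _].
have SP s : s \in S -> [/\ s \in facets K, s \in homology_facets K lt & first_flat M s = F].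
  by rewrite [s \in S]inE => /andP[hs /eqP e]; split=> //; exact: homology_facet_in.
rewrite -(restriction_homology_card fF (hI fF)).
have [eF|nE] := eqVneq F E.
  have -> : ((tutte (mcontraction M F)).[1, 0] = 1)%R.
    by rewrite eF tutte_mcontraction_ground.
  rewrite mulr1; congr Posz.
  have <- : [set ypart s | s in S] = homI F.
    apply/setP => I; apply/imsetP/idP => [[s /SP[sK hs es] ->]|hI'].
      by move: hs; rewrite homology_facetE // es => /andP[].
    have := hI'; rewrite inE => /andP[/(restriction_facetP fF)[iI sI cI] _].
    have [|sK es] := simplex_facet fF iI sI cI (flag_above0 M F).
      by rewrite cards0 add0n eF.
    exists (simplex I set0); last by rewrite ypart_simplex.
    by rewrite [_ \in S]inE homology_facetE // es ypart_simplex hI' eF !eqxx.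
  rewrite card_in_imset // => s t /SP[sK _ es] /SP[tK _ et] ey; apply: parts_inj => //.
  by rewrite (facet_xpart0 sK) ?(facet_xpart0 tK) ?es ?et.
rewrite -(bergman_homology_card fF nE (hB fF nE)) -PoszM -cardsX; congr Posz.
have <- : [set (ypart s, flag M s) | s in S] =
    setX (homI F)
         (homB F).
  apply/setP => -[I D]; rewrite in_setX.
  apply/imsetP/andP => [[s /SP[sK hs es] [-> ->]]|[hI' hD]].
    by move: hs; rewrite homology_facetE // es (negPf nE) => /andP[].
  have := hI'; rewrite [in X in X -> _]inE => /andP[/(restriction_facetP fF)[iI sI cI] _].
  have := hD; rewrite [in X in X -> _]inE => /andP[/(bergman_facetP fF nE)[DN cD] _].
  have [fD FD eD] := thicken_flag fF DN.
  have [|sK es] := simplex_facet fF iI sI cI (flag_above_bottomU fF nE fD).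
    rewrite cardsU1 FD -(card_shrink fD) eD cD add1n prednK ?subn_gt0 ?rk_lt_ground //.
    by rewrite subnK ?rk_ground.
  have ef : flag M (simplex I (F |: thicken F D)) = D.
    by rewrite flagE es xpart_simplex setU1K // eD.
  exists (simplex I (F |: thicken F D)); last by rewrite ef ypart_simplex.
  by rewrite [_ \in S]inE homology_facetE // es ypart_simplex ef hI' hD orbT eqxx.
rewrite card_in_imset // => s t /SP[sK _ es] /SP[tK _ et] [ey ef]; apply: parts_inj => //.
have sF : F \in xpart s by rewrite -es facet_first_flat // es.
have tF : F \in xpart t by rewrite -et facet_first_flat // et.
rewrite -(setD1K sF) -(setD1K tF); congr (_ |: _).
have /aug_facetP[/aug_bergmanP[_ fs] _] := sK; rewrite es in fs.
have /aug_facetP[/aug_bergmanP[_ ft] _] := tK; rewrite et in ft.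
apply: (shrink_inj (M := M) (F := F)).
- exact: flag_above_subset fs (subsetDl _ _).
- exact: flag_above_subset ft (subsetDl _ _).
- by move: ef; rewrite !flagE es et.
Qed.

Lemma basis_to_flag_card :
  (#|homology_facets K lt|%:Z = \sum_(F in flats M)
     (tutte (mrestriction M F)).[0, 1] * (tutte (mcontraction M F)).[1, 0])%R.
Proof.
rewrite -(eq_bigr _ (fun F hF => basis_to_flag_count hF)).
rewrite -sum1_card (partition_big (first_flat M) (mem (flats M))) /=; last first.
  move=> s; rewrite inE => /andP[/facet_aug/aug_bergmanP[iy _] _].
  exact: first_flat_flat.
rewrite -natz natr_sum; apply: eq_bigr => F _.
by rewrite natz -sum1_card; congr Posz; apply: eq_bigl => s; rewrite [in RHS]inE.
Qed.

End BasisToFlag.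

(** * Realizations, spheres and wedges *)

From mathcomp Require Import all_classical all_analysis wedge_sigT.
Import numFieldNormedType.Exports.

Section ContinuousFunctions.
Local Open Scope ring_scope.
Local Open Scope classical_set_scope.
Variables (R : realType) (Y : topologicalType).
Implicit Types f g : Y -> R.

Lemma eq_continuous f g : f =1 g -> continuous g -> continuous f.
Proof. by move=> /funext->. Qed.

Lemma continuousC (c : R) : continuous (fun _ : Y => c).
Proof. by move=> y; apply: cvg_cst. Qed.

Lemma continuousDf f g : continuous f -> continuous g ->
  continuous (fun y => f y + g y).
Proof. by move=> cf cg y; apply: cvgD; [apply: cf | apply: cg]. Qed.

Lemma continuousNf f : continuous f -> continuous (fun y => - f y).
Proof. by move=> cf y; apply: cvgN; apply: cf. Qed.

Lemma continuousBf f g : continuous f -> continuous g ->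
  continuous (fun y => f y - g y).
Proof. by move=> cf cg; apply: continuousDf cf (continuousNf cg). Qed.

Lemma continuousMf f g : continuous f -> continuous g ->
  continuous (fun y => f y * g y).
Proof. by move=> cf cg y; apply: cvgM; [apply: cf | apply: cg]. Qed.

Lemma continuousVf f : (forall y, f y != 0) -> continuous f ->
  continuous (fun y => (f y)^-1).
Proof. by move=> f0 cf y; apply: cvgV; [apply: f0 | apply: cf]. Qed.

Lemma continuous_maxf f g : continuous f -> continuous g ->
  continuous (fun y => Num.max (f y) (g y)).
Proof. by move=> cf cg y; apply: continuous_max; [apply: cf | apply: cg]. Qed.

Lemma continuous_minf f g : continuous f -> continuous g ->
  continuous (fun y => Num.min (f y) (g y)).
Proof. by move=> cf cg y; apply: continuous_min; [apply: cf | apply: cg]. Qed.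

Lemma continuous_bigf (op : R -> R -> R) (I : Type) (r : seq I) (P : pred I)
    (f0 : Y -> R) (f : I -> Y -> R) :
  (forall f g, continuous f -> continuous g -> continuous (fun y => op (f y) (g y))) ->
  continuous f0 -> (forall i, P i -> continuous (f i)) ->
  continuous (fun y => \big[op/f0 y]_(i <- r | P i) f i y).
Proof.
move=> cop c0 cf; elim: r => [|i r IHr].
  by apply: eq_continuous c0 => y; rewrite big_nil.
have [Pi|Pi] := boolP (P i).
  by apply: (eq_continuous _ (cop _ _ (cf i Pi) IHr)) => y; rewrite big_cons Pi.
by apply: eq_continuous IHr => y; rewrite big_cons (negPf Pi).
Qed.

End ContinuousFunctions.

Section Realization.
Local Open Scope ring_scope.
Local Open Scope classical_set_scope.
Variables (R : realType) (V : finType) (K : {set {set V}}).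

Lemma vertex_continuous v :
  continuous (fun x : realization R K => (val x : V -> R) v).
Proof.
move=> x; apply: (@continuous_comp _ _ _
  (val : realization R K -> {ptws V -> R}) (fun f => f v)).
  exact: initial_continuous.
exact: (@proj_continuous V (fun=> R) v).
Qed.

Lemma realization_continuous (Y : topologicalType) (f : Y -> realization R K) :
  (forall v, continuous (fun y => (val (f y) : V -> R) v)) -> continuous f.
Proof.
move=> cf; apply: continuous_comp_initial.
move=> y; apply/cvg_sup.
move=> v; move: y.
apply/(@continuousP _ (initial_topology (fun g : V -> R => g v))) => A [B oB <-].
rewrite -comp_preimage; apply: open_comp oB => y _; exact: cf.
Qed.

Lemma realization_sum (x : realization R K) : \sum_v (val x : V -> R) v = 1.
Proof. by case: x => x /= /set_mem[]. Qed.

Lemma realization_neq0 (x : realization R K) : exists v, (val x : V -> R) v != 0.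
Proof.
apply: contrapT => h; have := realization_sum x; rewrite big1 => [/esym/eqP|v _].
  by rewrite oner_eq0.
by apply/eqP/negPn/negP => hv; apply: h; exists v.
Qed.

Lemma realization_inj (x y : realization R K) :
  (forall v, (val x : V -> R) v = (val y : V -> R) v) -> x = y.
Proof. by move=> h; apply: val_inj; apply/funext. Qed.

(** Unnormalized points: maps into a realization are given by weights up to a positive factor, and
    the total mass is divided out at the end. *)
Definition cone (w : V -> R) : Prop :=
  [/\ forall v, 0 <= w v, 0 < \sum_v w v & [set v | w v != 0]%SET \in K].

Lemma normalize_subproof w : cone w ->
  ((fun v => w v / \sum_v w v) : {ptws V -> R}) \in realization_set K.
Proof.
move=> [w0 sw Kw]; rewrite inE; split=> [v||].
- by rewrite mulr_ge0 // invr_ge0 ltW.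
- by rewrite -mulr_suml mulfV // gt_eqF.
- congr (_ \in K): Kw; apply/setP => v.
  by rewrite !inE mulf_eq0 invr_eq0 (gt_eqF sw) orbF.
Qed.

Definition normalize w (cw : cone w) : realization R K :=
  exist (fun x => x \in realization_set K) _ (normalize_subproof cw).

Lemma normalize_continuous (Y : topologicalType) (w : Y -> V -> R)
    (cw : forall y, cone (w y)) :
  (forall v, continuous (w^~ v)) -> continuous (fun y => normalize (cw y)).
Proof.
move=> hw; apply: realization_continuous => v /=.
apply: continuousMf; first exact: hw.
apply: continuousVf => [y|]; first by have [_ /gt_eqF->] := cw y.
by apply: continuous_bigf => //; [apply: continuousDf | apply: continuousC].
Qed.

Lemma normalize_eq w (cw : cone w) w' (cw' : cone w') c : 0 < c ->
  (forall v, w' v = c * w v) -> normalize cw = normalize cw'.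
Proof.
move=> c0 e; apply: realization_inj => v /=.
under [in RHS]eq_bigr do rewrite e.
by rewrite -mulr_sumr e invfM mulrACA mulfV ?mul1r // gt_eqF.
Qed.

Lemma realization_cone (x : realization R K) : cone (val x).
Proof. by case: x => x /= /set_mem[x0 sx Kx]; split=> //; rewrite sx. Qed.

End Realization.

(** * Spheres as spaces of rays *)

Section SphereDirections.
Local Open Scope ring_scope.
Local Open Scope classical_set_scope.
Variables (R : realType) (m : nat).
Local Notation n := m.+1.
Local Notation S := (sphere R n).
Implicit Types (z : 'rV[R]_n) (d : 'I_n -> R).

Lemma rV_continuous (Y : topologicalType) (f : Y -> 'rV[R]_n) :
  (forall j, continuous (fun y => f y ord0 j)) -> continuous f.
Proof.
move=> cf y A [P nP sPA].
have h : \forall y' \near y, forall j, P ord0 j (f y' ord0 j).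
  by apply: filter_forall => j; apply: cf; apply: nP.
apply: filterS h => y' hy'; apply: sPA => i j; rewrite ord1; exact: hy'.
Qed.

(* These coordinates turn the base point into (1, ..., 1). *)
Definition shear z : 'I_n -> R :=
  fun j => z ord0 j + (if j == ord0 then 0 else z ord0 ord0).

Definition unshear d : 'rV[R]_n :=
  \row_j (d j - (if j == ord0 then 0 else d ord0)).

Lemma shearK z : unshear (shear z) = z.
Proof.
apply/rowP => j; rewrite !mxE /shear eqxx addr0.
by case: eqP => [->|_]; rewrite ?subr0 ?addr0 ?addrK.
Qed.

Lemma unshearK d j : shear (unshear d) j = d j.
Proof. by rewrite /shear !mxE eqxx subr0; case: eqP => [->|_]; lra. Qed.

Lemma unshearZ c d : unshear (fun j => c * d j) = c *: unshear d.
Proof. by apply/rowP => j; rewrite !mxE; case: eqP => _; ring. Qed.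

Lemma shearZ c z j : shear (c *: z) j = c * shear z j.
Proof. by rewrite /shear !mxE; case: eqP => _; ring. Qed.

Definition sqnorm z : R := \sum_j z ord0 j ^+ 2.

Lemma sqnormZ c z : sqnorm (c *: z) = c ^+ 2 * sqnorm z.
Proof. by rewrite /sqnorm mulr_sumr; apply: eq_bigr => j _; rewrite mxE exprMn. Qed.

Definition nonzero d := exists j, d j != 0.

Lemma sqnorm_unshear_gt0 d : nonzero d -> 0 < sqnorm (unshear d).
Proof.
move=> [j dj]; rewrite lt_neqAle sumr_ge0 ?andbT => [|i _]; last exact: sqr_ge0.
apply: contra dj => /eqP/esym/psumr_eq0P h.
have z0 : unshear d = 0.
  apply/rowP => i; rewrite [RHS]mxE; apply/eqP; rewrite -sqrf_eq0 h // => k _.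
  exact: sqr_ge0.
by rewrite -(unshearK d j) /shear z0 !mxE; case: ifP; rewrite addr0.
Qed.

Lemma dir_subproof d : nonzero d ->
  (Num.sqrt (sqnorm (unshear d)))^-1 *: unshear d \in S.
Proof.
move=> /sqnorm_unshear_gt0 h; rewrite inE /sphere /=.
rewrite -[LHS]/(sqnorm _) sqnormZ exprVn sqr_sqrtr ?ltW // mulVf //.
by rewrite gt_eqF.
Qed.

(** A point of the sphere is given by any vector on its ray in sheared coordinates, so a homotopy
    may be any continuous formula that avoids the zero vector. *)
Definition dir d (nz : nonzero d) : S :=
  exist (fun z => z \in S) _ (dir_subproof nz).

Lemma dir_continuous (Y : topologicalType) (d : Y -> 'I_n -> R)
    (nz : forall y, nonzero (d y)) :
  (forall j, continuous (fun y => d y j)) -> continuous (fun y => dir (nz y)).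
Proof.
move=> cd; apply: continuous_comp_initial; apply: rV_continuous => j /=.
have cu i : continuous (fun y => unshear (d y) ord0 i).
  apply: (@eq_continuous _ _ _ (fun y => d y i - (if i == ord0 then 0 else d y ord0))).
    by move=> y; rewrite mxE.
  by apply: continuousBf => //; case: (i == ord0) => //; exact: continuousC.
apply: (@eq_continuous _ _ _ (fun y =>
  (Num.sqrt (sqnorm (unshear (d y))))^-1 * unshear (d y) ord0 j)).
  by move=> y; rewrite !set_valE /= mxE.
apply: continuousMf => //; apply: continuousVf => [y|].
  by rewrite gt_eqF // sqrtr_gt0 sqnorm_unshear_gt0.
move=> y; apply: (@continuous_comp _ _ _ (fun y => sqnorm (unshear (d y))) Num.sqrt).
  apply: continuous_bigf => [f g cf cg||i _]; first exact: continuousDf.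
    exact: continuousC.
  exact: (continuousMf (cu i) (cu i)).
exact: sqrt_continuous.
Qed.

Lemma dir_eq d (nz : nonzero d) d' (nz' : nonzero d') c : 0 < c ->
  (forall j, d' j = c * d j) -> dir nz = dir nz'.
Proof.
move=> c0 e; apply: val_inj => /=; have {e nz'}-> : d' = (fun j => c * d j) by apply/funext.
rewrite unshearZ sqnormZ sqrtrM ?sqr_ge0 // sqrtr_sqr gtr0_norm //.
by rewrite invfM scalerA -mulrA [_^-1 * c]mulrC mulrA mulVf ?mul1r // gt_eqF.
Qed.

Lemma shear_dir d (nz : nonzero d) :
  exists2 c, 0 < c & forall j, shear (val (dir nz)) j = c * d j.
Proof.
exists (Num.sqrt (sqnorm (unshear d)))^-1.
  by rewrite invr_gt0 sqrtr_gt0 sqnorm_unshear_gt0.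
by move=> j; rewrite shearZ unshearK.
Qed.

Lemma sqnorm_sphere (z : S) : sqnorm (val z) = 1.
Proof. by case: z => z /= /set_mem. Qed.

Lemma shear_nonzero (z : S) : nonzero (shear (val z)).
Proof.
apply: contrapT => h; have := sqnorm_sphere z.
rewrite -[val z]shearK (_ : unshear _ = 0).
  by rewrite /sqnorm big1 => [/esym/eqP|j _]; rewrite ?oner_eq0 // mxE expr0n.
have e j : shear (val z) j = 0 by apply/eqP/negPn/negP => hj; apply: h; exists j.
by apply/rowP => j; rewrite !mxE !e; case: ifP; rewrite subr0.
Qed.

Lemma dir_shear (z : S) (nz : nonzero (shear (val z))) : dir nz = z.
Proof.
by apply: val_inj => /=; rewrite shearK sqnorm_sphere sqrtr1 invr1 scale1r.
Qed.

Lemma shear_continuous j : continuous (fun z : S => shear (val z) j).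
Proof.
have c i : continuous (fun z : S => (val z : 'rV_n) ord0 i).
  move=> z; apply: (@continuous_comp _ _ _ (val : S -> 'rV_n) (fun M : 'rV_n => M ord0 i)).
    exact: initial_continuous.
  exact: coord_continuous.
by apply: continuousDf => //; case: (j == ord0) => //; exact: continuousC.
Qed.

Lemma shear_base j : shear (val (sphere_base R m)) j = 1.
Proof.
by rewrite /shear !mxE !eqxx /=; case: (j == ord0); rewrite ?addr0 ?add0r.
Qed.

Lemma dir_const d (nz : nonzero d) c : 0 < c -> (forall j, d j = c) ->
  dir nz = sphere_base R m.
Proof.
move=> c0 e; rewrite -[RHS](dir_shear (shear_nonzero _)); apply: (@dir_eq _ _ _ _ c^-1).
  by rewrite invr_gt0.
by move=> j; rewrite shear_base e mulVf // gt_eqF.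
Qed.

Lemma closed_sphere_base : closed [set sphere_base R m].
Proof.
pose f (z : S) := \sum_j (shear (val z) j - 1) ^+ 2.
have -> : [set sphere_base R m] = f @^-1` [set x | x = 0].
  apply/seteqP; split=> [z /= ->|z /=].
    by apply: big1 => j _; rewrite shear_base subrr expr0n.
  move/psumr_eq0P => h; rewrite -(dir_shear (shear_nonzero z)).
  apply: (@dir_const _ _ 1) => // j; apply/eqP; rewrite -subr_eq0 -sqrf_eq0.
  by rewrite h // => i _; exact: sqr_ge0.
apply: closed_comp (@closed_eq R 0) => z _; move: z.
apply: continuous_bigf => [g h cg ch||j _]; first exact: continuousDf.
  exact: continuousC.
have c1 : continuous (fun z : S => shear (val z) j - 1).
  by apply: continuousBf; [exact: shear_continuous | exact: continuousC].
exact: (continuousMf c1 c1).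
Qed.

End SphereDirections.

(** * Maps into and out of wedges *)

Section WedgeMaps.
Local Open Scope ring_scope.
Local Open Scope classical_set_scope.
Variables (b : nat) (X : 'I_b -> topologicalType) (p : forall k, X k).
Hypothesis clp : forall k, closed [set p k].

(** All summands except the [k]-th are collapsed to the base point. *)
Definition wedge_proj (k : 'I_b) : wedge p -> X k :=
  wedge_fun (fun j (x : X j) => dfwith p j x k).

Lemma dfwith_base (j : 'I_b) : dfwith p j (p j) = p.
Proof. by apply: functional_extensionality_dep => k; case: dfwithP. Qed.

Lemma wedge_proj_lift k j (x : X j) :
  wedge_proj k (wedge_lift p x) = dfwith p j x k.
Proof. by rewrite /wedge_proj wedge_lift_funE // => i l; rewrite !dfwith_base. Qed.

Lemma wedge_proj_continuous k : continuous (wedge_proj k).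
Proof.
apply: wedge_fun_continuous => [j|i j]; last by rewrite !dfwith_base.
move=> x; apply: (@continuous_comp _ (prod_topology X) _ (dfwith p j) (proj k)).
  exact: dfwith_continuous.
exact: proj_continuous.
Qed.

Lemma wedge_liftP (w : wedge p) : exists k (x : X k), w = wedge_lift p x.
Proof.
have : [set: wedge p] w by [].
by rewrite -wedgeTE => -[k _ [x _ <-]]; exists k, x.
Qed.

(** Where [F y] is the base point, the finitely many components are all near their base points
    around [y]. Elsewhere one component stays off its base point near [y], base points being closed,
    and there it determines [F]. The index may thus depend discontinuously on [y]. *)
Lemma wedge_continuous (Y : topologicalType) (F : Y -> wedge p)
    (q : forall k, Y -> X k) :
  (forall k, continuous (q k)) ->
  (forall y, exists2 k, F y = wedge_lift p (q k y) &
     forall j, j != k -> q j y = p j) ->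
  continuous F.
Proof.
move=> cq hF y U /=.
have base k j : wedge_lift p (p k) = wedge_lift p (p j).
  by apply: wedge_liftE; [exact: p j | exact: p k].
have hF' y' k : q k y' != p k -> F y' = wedge_lift p (q k y').
  have [j -> hj] := hF y'; have [->//|/negPf jk] := eqVneq k j.
  by rewrite hj ?jk // eqxx.
have [k Fy hk] := hF y; have [qp|qp] := eqVneq (q k y) (p k).
  rewrite Fy qp => nU.
  have h : \forall y' \near y, forall j, U (wedge_lift p (q j y')).
    apply: filter_forall => j; apply: (cq j y [set x | U (wedge_lift p x)]).
    apply: (@wedge_lift_continuous _ _ p j).
    have -> : q j y = p j by have [->//|/hk//] := eqVneq j k.
    by rewrite (base j k).
  apply: filterS h => y' h; have [j e _] := hF y'.
  by rewrite /preimage /= e.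
rewrite Fy => nU.
have h1 : \forall y' \near y, q k y' != p k.
  apply: (cq k y [set x | x != p k]).
  apply: (@open_nbhs_nbhs _ _ [set x | x != p k]); split=> //=.
  rewrite (_ : [set _ | _] = ~` [set p k]); first exact: closed_openC.
  by apply/seteqP; split=> x /= /eqP.
have h2 : \forall y' \near y, U (wedge_lift p (q k y')).
  by apply: (cq k y [set x | U (wedge_lift p x)]); apply: (@wedge_lift_continuous _ _ p k).
apply: filterS2 h1 h2 => y' /hF' e h.
by rewrite /preimage /= e.
Qed.

End WedgeMaps.

(** * The homotopy equivalence *)

Section Flow.
Local Open Scope ring_scope.
Local Open Scope classical_set_scope.
Variables (R : realType) (T : finType) (M : matroid T).
Implicit Types (a : T -> R) (c : {set T} -> R) (t : R) (F G : {set T}).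

(** The least level s >= 0 at which the set of [i] with [a i > s] lies in [F]. Its closure is [F]
    when, in addition, s is below the value for every flat properly inside [F]; this is what
    [out_min] records. *)
Definition out_max a F : R := \big[Num.max/0]_(i | i \notin F) a i.

Definition out_min a t F : R :=
  \big[Num.min/t]_(G in flats M | G \proper F) out_max a G.

(* The measure of the levels [0 <= s < t] for which the set of [i] with [a i > s]
   has closure [F]. *)
Definition level_weight a t F : R :=
  if F \in flats M :\ ground M then Num.max 0 (out_min a t F - out_max a F) else 0.

Definition flow a c t (x : T + {set T}) : R :=
  match x with
  | inl i => Num.max 0 (a i - t)
  | inr F => c F + level_weight a t F
  end.

Definition simplicial a c : Prop :=
  [/\ [set i | a i != 0]%SET \in indep M,
      forall F, c F != 0 -> F \in flats M :\ ground M,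
      forall F G, c F != 0 -> c G != 0 -> (F \subset G) || (G \subset F) &
      forall F i, c F != 0 -> a i != 0 -> i \in F].

Lemma simplicialP (w : T + {set T} -> R) :
  [set x | w x != 0]%SET \in aug_bergman M <->
  simplicial (fun i => w (inl i)) (fun F => w (inr F)).
Proof.
have ey : ypart [set x | w x != 0]%SET = [set i | w (inl i) != 0]%SET.
  by apply/setP => i; rewrite !inE.
have ex F : (F \in xpart [set x | w x != 0]%SET) = (w (inr F) != 0) by rewrite !inE.
rewrite inE ey; split=> [/and4P[iy /fintype.subsetP sx cx /forall_inP yx]|[iy sx cx yx]].
  split=> // [F wF|F G wF wG|F i wF wi]; first by apply: sx; rewrite ex.
    by move/forall_inP: cx => /(_ F); rewrite ex => /(_ wF)/forall_inP/(_ G); rewrite ex; apply.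
  by move: (yx F); rewrite ex => /(_ wF)/fintype.subsetP/(_ i); rewrite inE; apply.
apply/and4P; split=> //.
- by apply/fintype.subsetP => F; rewrite ex; apply: sx.
- apply/forall_inP => F; rewrite ex => wF; apply/forall_inP => G; rewrite ex => wG.
  exact: cx.
- apply/forall_inP => F; rewrite ex => wF; apply/fintype.subsetP => i; rewrite inE => wi.
  exact: yx.
Qed.

Lemma out_max_ge a F i : i \notin F -> a i <= out_max a F.
Proof. by move=> iF; apply: le_bigmax_cond. Qed.

Lemma out_max_ge0 a F : 0 <= out_max a F.
Proof. exact: bigmax_ge_id. Qed.

Lemma out_max_eq0 a F : (forall i, a i != 0 -> i \in F) -> out_max a F = 0.
Proof.
move=> h; apply: le_anti; rewrite out_max_ge0 andbT; apply/bigmax_leP; split=> // i.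
by move=> iF; rewrite leNgt; apply: contra iF => ai; apply: h; rewrite gt_eqF.
Qed.

Lemma out_maxI a F G : out_max a (F :&: G) <= Num.max (out_max a F) (out_max a G).
Proof.
apply/bigmax_leP; split=> [|i]; first by rewrite le_max out_max_ge0.
by rewrite inE negb_and le_max => /orP[] /(out_max_ge a) ->; rewrite ?orbT.
Qed.

Lemma level_weight_ge0 a t F : 0 <= level_weight a t F.
Proof. by rewrite /level_weight; case: ifP => // _; rewrite le_max lexx. Qed.

Lemma level_weight_neq0 a t F : level_weight a t F != 0 ->
  [/\ F \in flats M :\ ground M, out_max a F < t &
      forall G, G \in flats M -> G \proper F -> out_max a F < out_max a G].
Proof.
rewrite /level_weight; case: ifP => [fF|_]; last by rewrite eqxx.
have [h|] := leP (out_min a t F - out_max a F) 0.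
  by rewrite eqxx.
rewrite subr_gt0 => /bigmin_gtP[h1 h2] _; split=> // G fG pG.
by apply: h2; rewrite fG.
Qed.

Lemma level_weight0 a F : level_weight a 0 F = 0.
Proof.
apply/eqP/negPn/negP => /level_weight_neq0[_].
by rewrite ltNge out_max_ge0.
Qed.

(* If [F] is not below [G], then [F :&: G] is a flat properly below [F]. *)
Lemma level_weight_sub a t F G : level_weight a t F != 0 -> G \in flats M ->
  out_max a G <= out_max a F -> F \subset G.
Proof.
move=> /level_weight_neq0[]; rewrite inE => /andP[_ fF] _ h fG leGF.
have := h _ (flatI fF fG); rewrite properE finset.subsetIl /= finset.subsetI subxx /=.
case: (F \subset G) => // /(_ isT); rewrite ltNge.
by rewrite (le_trans (out_maxI a F G)) // ge_max lexx.
Qed.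

(** The flats that receive mass are closures of superlevel sets, hence nested. They lie in every
    flat already present, which contains the whole support of [a], and they contain each remaining
    [i], whose weight exceeds all levels below [t]. *)
Lemma flow_simplicial a c t : (forall i, 0 <= a i) -> simplicial a c -> 0 <= t ->
  simplicial (fun i => flow a c t (inl i)) (fun F => flow a c t (inr F)).
Proof.
move=> a0 [ia fc cc ac] t0.
have ha i : flow a c t (inl i) != 0 -> t < a i.
  rewrite /flow; have [h|h _] := leP (a i - t) 0; last by rewrite -subr_gt0.
  by rewrite eqxx.
have ha0 i : flow a c t (inl i) != 0 -> a i != 0.
  by move=> /ha h; rewrite gt_eqF // (le_lt_trans t0).
have hc F : flow a c t (inr F) != 0 -> c F != 0 \/ level_weight a t F != 0.
  rewrite /flow; have [->|] := eqVneq (c F) 0; last by left.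
  by rewrite add0r; right.
have lc F G : c F != 0 -> level_weight a t G != 0 -> G \subset F.
  move=> cF wG; have := fc F cF; rewrite inE => /andP[_ fF].
  apply: (level_weight_sub wG fF); rewrite out_max_eq0 ?out_max_ge0 // => i.
  exact: ac.
split.
- by apply: indep_sub ia _; apply/fintype.subsetP => i; rewrite !inE => /ha0.
- by move=> F /hc[/fc //|/level_weight_neq0[]].
- move=> F G /hc[cF|wF] /hc[cG|wG]; first exact: cc.
  + by rewrite (lc F G) ?orbT.
  + by rewrite (lc G F).
  + have [+ _ _] := level_weight_neq0 wF; rewrite inE => /andP[_ fF].
    have [+ _ _] := level_weight_neq0 wG; rewrite inE => /andP[_ fG].
    case/orP: (le_total (out_max a F) (out_max a G)) => h.
      by rewrite (level_weight_sub wG fF h) orbT.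
    by rewrite (level_weight_sub wF fG h).
- move=> F i /hc[cF /ha0|wF /ha ti]; first exact: ac.
  apply/negPn/negP => /(out_max_ge a) h; have [_ + _] := level_weight_neq0 wF.
  by rewrite ltNge (le_trans _ h) // ltW.
Qed.

Lemma flow_ge0 a c t x : (forall F, 0 <= c F) -> 0 <= flow a c t x.
Proof.
move=> c0; case: x => [i|F] /=; first by rewrite le_max lexx.
by rewrite addr_ge0 // level_weight_ge0.
Qed.

Lemma flow0 a c x : (forall i, 0 <= a i) ->
  flow a c 0 x = match x with inl i => a i | inr F => c F end.
Proof.
move=> a0; case: x => [i|F] /=; first by rewrite subr0; apply/max_idPr.
by rewrite level_weight0 addr0.
Qed.

(** The levels just below [t] give mass to a smallest proper flat [F] with [out_max a F < t]. The
    flat [G] provides a candidate: if the support spans the ground set, all mass may be lost. *)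
Lemma flow_gt0 a c t G : (forall F, 0 <= c F) -> 0 < t ->
  G \in flats M :\ ground M -> (forall i, a i != 0 -> i \in G) ->
  exists x, 0 < flow a c t x.
Proof.
move=> c0 t0 fG hG.
pose P F := (F \in flats M :\ ground M) && (out_max a F < t).
have PG : P G by rewrite /P fG out_max_eq0.
case: (arg_minnP (fun F : {set T} => #|F|) PG) => F /andP[fF uF] minF.
exists (inr F) => /=; apply: ltr_wpDl => //.
rewrite /level_weight fF lt_max subr_gt0; apply/orP; right.
apply/bigmin_gtP; split=> // H /andP[fH pH].
apply: (lt_le_trans uF); rewrite leNgt; apply/negP => uH.
have /minF : P H.
  rewrite /P uH andbT in_setD1 fH andbT; apply/eqP => eH.
  move: fF pH; rewrite eH inE => /andP[_ /flat_subset sF].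
  by rewrite properE sF andbF.
by rewrite leqNgt proper_card.
Qed.

Lemma flow_cone a c t : (forall i, 0 <= a i) -> (forall F, 0 <= c F) ->
  simplicial a c -> 0 <= t -> (exists x, flow a c t x != 0) ->
  cone (aug_bergman M) (flow a c t).
Proof.
move=> a0 c0 sac t0 [x nx]; split=> [y||]; first exact: flow_ge0.
- rewrite (bigD1 x) //= ltr_pwDl ?sumr_ge0 // => [|y _]; last exact: flow_ge0.
  by rewrite lt_neqAle eq_sym nx flow_ge0.
- exact/simplicialP/flow_simplicial.
Qed.

(** Homogeneity makes the flow compatible with rays and with normalization. *)
Lemma flowZ l a c t x : 0 <= l ->
  flow (fun i => l * a i) (fun F => l * c F) (l * t) x = l * flow a c t x.
Proof.
move=> l0.
have eu F : out_max (fun i => l * a i) F = l * out_max a F.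
  by rewrite /out_max (big_morph _ (fun y z => maxr_pMr y z l0) (mulr0 l)).
case: x => [i|F] /=; first by rewrite -mulrBr -[0 in LHS](mulr0 l) maxr_pMr ?mulr0.
rewrite mulrDr /level_weight; case: ifP => _; rewrite ?mulr0 // eu.
rewrite /out_min; under eq_bigr do rewrite eu.
rewrite -(big_morph (fun x => l * x) (fun y z => minr_pMr y z l0) (erefl (l * t))).
by rewrite -mulrBr -[0 in LHS](mulr0 l) maxr_pMr ?mulr0.
Qed.

Lemma flow_continuous (Y : topologicalType) (a : Y -> T -> R) (c : Y -> {set T} -> R)
    (t : Y -> R) x :
  (forall i, continuous (fun y => a y i)) -> (forall F, continuous (fun y => c y F)) ->
  continuous t -> continuous (fun y => flow (a y) (c y) (t y) x).
Proof.
move=> ca cc ct; case: x => [i|F] /=.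
  by apply: continuous_maxf; [exact: continuousC|exact: continuousBf].
have cu G : continuous (fun y => out_max (a y) G).
  apply: continuous_bigf => //; [exact: continuous_maxf|exact: continuousC].
apply: continuousDf => //; rewrite /level_weight.
case: (_ \in _); last exact: continuousC.
apply: continuous_maxf; first exact: continuousC.
apply: continuousBf => //.
by apply: continuous_bigf => //; exact: continuous_minf.
Qed.

End Flow.

Section MinCoordinate.
Local Open Scope ring_scope.
Local Open Scope classical_set_scope.
Variables (R : realType) (m : nat).
Implicit Types d : 'I_m.+1 -> R.

Definition min_coord d : R := \big[Num.min/d ord0]_j d j.

Lemma min_coord_le d j : min_coord d <= d j.
Proof. exact: bigmin_le_cond. Qed.

Lemma min_coord_ex d : exists j, d j = min_coord d.
Proof.
rewrite /min_coord.
apply: (big_ind (fun c => exists j, d j = c)) => [|x y [i <-] [j <-]|j _].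
- by exists ord0.
- by rewrite /Num.min; case: ifP => _; [exists i | exists j].
- by exists j.
Qed.

Lemma min_coordP d c : (forall j, c <= d j) -> (exists j, d j = c) -> min_coord d = c.
Proof.
move=> h [j e]; apply: le_anti; rewrite -{1}e min_coord_le /=.
by have [i <-] := min_coord_ex d.
Qed.

Lemma min_coord_continuous (Y : topologicalType) (d : Y -> 'I_m.+1 -> R) :
  (forall j, continuous (fun y => d y j)) -> continuous (fun y => min_coord (d y)).
Proof. by move=> cd; apply: continuous_bigf => //; exact: continuous_minf. Qed.

End MinCoordinate.

Section Equivalence.
Local Open Scope ring_scope.
Local Open Scope classical_set_scope.
Variables (R : realType) (T : finType) (M : matroid T) (m : nat).
Hypothesis rM : rk M (ground M) = m.+1.
Local Notation b := #|bases M|.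
Local Notation n := m.+1%:R.
Local Notation X := (realization R (aug_bergman M)).
Local Notation V := (T + {set T})%type.
Implicit Types (k : 'I_b) (j : 'I_m.+1).

Definition basis k : {set T} := enum_val k.

Lemma basis_in k : basis k \in bases M.
Proof. exact: enum_valP. Qed.

Lemma basis_inj k k' : basis k \subset basis k' -> k = k'.
Proof.
move=> s; apply: enum_val_inj; apply/esym; apply: (indep_sup_basis (basis_in k)) s.
by have /basesP[] := basis_in k'.
Qed.

Lemma basis_diff k k' : k' != k -> exists2 i, i \in basis k' & i \notin basis k.
Proof. by move=> kk; apply/fintype.subsetPn; apply: contra kk => /basis_inj->. Qed.

Lemma basis_onto B : B \in bases M -> exists k, basis k = B.
Proof. by move=> h; exists (enum_rank_in h B); exact: enum_rankK_in. Qed.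

Lemma card_basis k : #|basis k| = m.+1.
Proof. by have /basesP[_ ->] := basis_in k. Qed.

Definition elt k j : T := enum_val (cast_ord (esym (card_basis k)) j).

Lemma elt_in k j : elt k j \in basis k.
Proof. exact: enum_valP. Qed.

Lemma elt_inj k : injective (elt k).
Proof. by move=> i j /enum_val_inj/cast_ord_inj. Qed.

Lemma elt_onto k i : i \in basis k -> exists j, elt k j = i.
Proof.
move=> h; exists (cast_ord (card_basis k) (enum_rank_in h i)).
by rewrite /elt cast_ordK enum_rankK_in.
Qed.

Lemma sum_basis k (a : T -> R) : \sum_(i in basis k) a i = \sum_j a (elt k j).
Proof.
rewrite (eq_bigl (mem [set elt k j | j in 'I_m.+1]%SET)) => [|i].
  by rewrite big_imset //= => i j _ _ /elt_inj.
by apply/idP/imsetP => [/elt_onto[j <-]|[j _ ->]]; [exists j | exact: elt_in].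
Qed.

(** Extension by zero: as [elt k] is injective, the sum has at most one term. *)
Definition ext k (d : 'I_m.+1 -> R) (i : T) : R := \sum_(j | elt k j == i) d j.

Lemma ext_elt k d j : ext k d (elt k j) = d j.
Proof.
rewrite /ext (bigD1 j) //= big1 ?addr0 // => i /andP[/eqP/elt_inj->].
by rewrite eqxx.
Qed.

Lemma ext_out k d i : i \notin basis k -> ext k d i = 0.
Proof.
move=> h; rewrite /ext big1 // => j /eqP e.
by rewrite -e elt_in in h.
Qed.

Lemma extP k d (a : T -> R) : (forall j, a (elt k j) = d j) ->
  (forall i, i \notin basis k -> a i = 0) -> ext k d = a.
Proof.
move=> h1 h2; apply/funext => i; have [/elt_onto[j <-]|h] := boolP (i \in basis k).
  by rewrite ext_elt h1.
by rewrite ext_out // h2.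
Qed.

(* On the realization, [low k] is positive exactly on the open simplex of
   [basis k]. *)
Definition low k (x : V -> R) : R := min_coord (fun j => x (inl (elt k j))).

Lemma simplicial_sub (a a' : T -> R) (c c' : {set T} -> R) : simplicial M a c ->
  (forall i, a' i != 0 -> a i != 0) -> (forall F, c' F != 0 -> c F != 0) ->
  simplicial M a' c'.
Proof.
move=> [ia fc cc ac] ha hc; split.
- by apply: indep_sub ia _; apply/fintype.subsetP => i; rewrite !inE => /ha.
- by move=> F /hc/fc.
- by move=> F G /hc hF /hc hG; apply: cc.
- by move=> F i /hc hF /ha hi; apply: ac.
Qed.

Lemma simplicial_basis k (a : T -> R) : (forall i, a i != 0 -> i \in basis k) ->
  simplicial M a (fun=> 0).
Proof.
move=> h; split=> [|F|F G|F i]; rewrite ?eqxx //.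
have /basesP[iB _] := basis_in k; apply: indep_sub iB _.
by apply/fintype.subsetP => i; rewrite inE; apply: h.
Qed.

Lemma proper_flat_supp (a : T -> R) : [set i | a i != 0]%SET \in indep M ->
  (forall k, exists2 i, i \in basis k & a i = 0) ->
  exists2 G, G \in flats M :\ ground M & forall i, a i != 0 -> i \in G.
Proof.
move=> iI hI; set I := [set i | _]%SET in iI.
exists (cl M I); last by move=> i hi; apply: (fintype.subsetP (cl_sub M I)); rewrite inE.
apply: indep_sub_proper_flat => //; rewrite ltn_neqAle indep_card_leq // andbT.
apply/eqP => cI; have /basis_onto[k ek] : I \in bases M by apply/basesP.
by have [i] := hI k; rewrite ek inE => /eqP.
Qed.

(** * Points of the open simplices spanned by the bases *)

Section Points.
Variable x : X.
Local Notation a i := ((val x : V -> R) (inl i)).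
Local Notation c F := ((val x : V -> R) (inr F)).

Lemma vertex_ge0 v : 0 <= (val x : V -> R) v.
Proof. by have [] := realization_cone x. Qed.

Lemma vertex_simplicial : simplicial M (fun i => a i) (fun F => c F).
Proof. by have [_ _ /simplicialP] := realization_cone x. Qed.

Lemma low_ge0 k : 0 <= low k (val x).
Proof.
by rewrite /low; have [j <-] := min_coord_ex (fun j => a (elt k j)); exact: vertex_ge0.
Qed.

Lemma low_le k i : i \in basis k -> low k (val x) <= a i.
Proof. by move=> /elt_onto[j <-]; exact: (min_coord_le (fun j => a (elt k j))). Qed.

(** The support is independent and contains the basis, hence equals it. *)
Lemma low_gt0_out k i : 0 < low k (val x) -> i \notin basis k -> a i = 0.
Proof.
move=> h iN; apply/eqP/negPn/negP => ai; have [ia _ _ _] := vertex_simplicial.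
have sB : basis k \subset [set i | a i != 0]%SET.
  by apply/fintype.subsetP => l lB; rewrite inE gt_eqF // (lt_le_trans h) // low_le.
have := indep_sup_basis (basis_in k) ia sB => /setP/(_ i).
by rewrite inE ai (negPf iN).
Qed.

Lemma low_gt0_flat k F : 0 < low k (val x) -> c F = 0.
Proof.
move=> h; apply/eqP/negPn/negP => cF; have [_ fc _ ac] := vertex_simplicial.
have := fc F cF; rewrite inE => /andP[+ fF]; rewrite inE => /negP; apply.
apply/eqP; apply: (flat_sup_basis (basis_in k) fF).
apply/fintype.subsetP => l lB; apply: ac => //.
by rewrite gt_eqF // (lt_le_trans h) // low_le.
Qed.

Lemma low_gt0_uniq k k' : 0 < low k (val x) -> k' != k -> low k' (val x) = 0.
Proof.
move=> h kk; have [i ik' ik] := basis_diff kk.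
by apply: le_anti; rewrite low_ge0 andbT -(low_gt0_out h ik) low_le.
Qed.

Lemma low_gt0_sum k : 0 < low k (val x) -> \sum_j a (elt k j) = 1.
Proof.
move=> h; rewrite -(realization_sum x) big_sumType /= [X in _ = _ + X]big1 ?addr0; last first.
  by move=> F _; exact: low_gt0_flat h.
rewrite (bigID (mem (basis k))) /= [X in _ = _ + X]big1 ?addr0; last first.
  by move=> i; exact: low_gt0_out.
by rewrite sum_basis.
Qed.

End Points.

(* As a direction, this is (1, ..., 1) off the open simplex of [basis k] and
   (-1, ..., -1) at its barycentre. *)
Definition pinch (x : V -> R) k : 'I_m.+1 -> R := fun j =>
  low k x * (x (inl (elt k j)) - low k x) + (1 - 2 * n * low k x).

Lemma pinch_base (x : V -> R) k j : low k x = 0 -> pinch x k j = 1.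
Proof. by rewrite /pinch => ->; rewrite mul0r mulr0 subr0 add0r. Qed.

Lemma sum_const (d : 'I_m.+1 -> R) c : (forall j, d j = c) -> \sum_j d j = n * c.
Proof.
move=> h; under eq_bigr do rewrite h.
by rewrite sumr_const card_ord mulr_natl.
Qed.

(** If the vector vanished, its entry at the minimal coordinate l would give 2 n l = 1. Then all
    coordinates equal l, and their sum gives n l = 1. *)
Lemma pinch_nonzero (x : X) k : nonzero (pinch (val x) k).
Proof.
apply: contrapT => h.
have e j : pinch (val x) k j = 0 by apply/eqP/negPn/negP => hj; apply: h; exists j.
move: e; rewrite /pinch; set l := low k _ => e.
have [j0 ej0] := min_coord_ex (fun j => (val x : V -> R) (inl (elt k j))).
have l1 : 2 * n * l = 1.
  by have := e j0; rewrite ej0 subrr mulr0 add0r => /eqP; rewrite subr_eq0 => /eqP.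
have l0 : l != 0 by apply: contra_eq_neq l1 => ->; rewrite mulr0 eq_sym oner_eq0.
have lp : 0 < l by rewrite lt_neqAle eq_sym l0 low_ge0.
have ea j : (val x : V -> R) (inl (elt k j)) = l.
  apply/eqP; rewrite -subr_eq0; have /eqP := e j.
  by rewrite l1 subrr addr0 mulf_eq0 (negPf l0).
by have := low_gt0_sum lp; rewrite (sum_const ea) => nl; move: l1; rewrite -mulrA nl; lra.
Qed.

Lemma low_continuous (Y : topologicalType) (x : Y -> V -> R) k :
  (forall i, continuous (fun y => x y (inl i))) -> continuous (fun y => low k (x y)).
Proof. by move=> cx; apply: min_coord_continuous. Qed.

Lemma pinch_continuous (Y : topologicalType) (x : Y -> V -> R) k j :
  (forall i, continuous (fun y => x y (inl i))) -> continuous (fun y => pinch (x y) k j).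
Proof.
move=> cx; have cl := low_continuous (k := k) cx.
apply: continuousDf; first by apply: continuousMf => //; apply: continuousBf.
by apply: continuousBf; [|apply: continuousMf]; try exact: continuousC.
Qed.

(** When no [low k x] is positive, every index leads to the base point, so any default will do. *)
Definition selected (x : V -> R) : 'I_b :=
  odflt (Ordinal (card_bases_gt0 M)) [pick k | 0 < low k x].

Lemma selectedP (x : X) k : k != selected (val x) -> low k (val x) = 0.
Proof.
rewrite /selected; case: pickP => [k' h|h] /= kk; first exact: low_gt0_uniq h kk.
by apply: le_anti; rewrite low_ge0 andbT leNgt h.
Qed.

Local Notation W := (wedge (fun _ : 'I_b => sphere_base R m)).
Local Notation lift k z := (@wedge_lift _ _ (fun _ : 'I_b => sphere_base R m) k z).

Definition collapse (x : X) : W :=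
  let k := selected (val x) in lift k (dir (pinch_nonzero x k)).

Lemma dir_pinch_base (x : X) k : low k (val x) = 0 ->
  dir (pinch_nonzero x k) = sphere_base R m.
Proof. by move=> h; apply: (@dir_const _ _ _ _ 1) => // j; exact: pinch_base. Qed.

Lemma collapse_continuous : continuous collapse.
Proof.
apply: (@wedge_continuous b _ _ (fun=> @closed_sphere_base R m) _ _
  (fun k x => dir (pinch_nonzero x k))) => [k|x].
  apply: dir_continuous => j.
  by apply: pinch_continuous => i; exact: vertex_continuous.
exists (selected (val x)) => // k /selectedP h.
exact: dir_pinch_base.
Qed.

Lemma collapseE (x : X) k : (forall k', k' != k -> low k' (val x) = 0) ->
  collapse x = lift k (dir (pinch_nonzero x k)).
Proof.
move=> h; rewrite /collapse; have [->//|ne] := eqVneq (selected (val x)) k.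
rewrite (dir_pinch_base (h _ ne)) (@dir_pinch_base x k); last first.
  by apply: selectedP; rewrite eq_sym.
by apply: wedge_liftE; exact: sphere_base.
Qed.

(* Directions with a nonpositive coordinate are folded onto the simplex of
   [basis k]; the positive ones follow the flow starting at its boundary. *)
Definition spread k (d : 'I_m.+1 -> R) : V -> R :=
  flow M (ext k (fun j => d j - min_coord d + Num.max 0 (- min_coord d)))
    (fun=> 0) (Num.max 0 (min_coord d)).

Lemma ext_ge0 k d i : (forall j, 0 <= d j) -> 0 <= ext k d i.
Proof. by move=> h; apply: sumr_ge0 => j _. Qed.

Lemma ext_neq0 k d i : ext k d i != 0 -> i \in basis k.
Proof. by apply: contraR => /(ext_out d)->. Qed.

Lemma spread_cone k d : nonzero d -> cone (aug_bergman M) (spread k d).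
Proof.
move=> [j0 dj0]; rewrite /spread; set mu := min_coord d; set a := ext k _.
have a0 i : 0 <= a i.
  by apply: ext_ge0 => j; rewrite addr_ge0 ?subr_ge0 ?min_coord_le // le_max lexx.
have sa : simplicial M a (fun=> 0) by apply: (@simplicial_basis k) => i; exact: ext_neq0.
apply: flow_cone => //; first by rewrite le_max lexx.
have [jm ejm] := min_coord_ex d.
have [mu0|mu0] := leP mu 0.
  have [mu1|mu1] := eqVneq mu 0.
    exists (inl (elt k j0)); rewrite flow0 //= /a ext_elt mu1 oppr0 maxxx.
    by rewrite !addr0.
  exists (inl (elt k jm)); rewrite flow0 //= /a ext_elt ejm -/mu subrr add0r.
  by rewrite (max_idPr _) ?oppr_eq0 ?oppr_ge0.
(* For a positive minimum, subtracting it makes a coordinate of the basis vanish, so the support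
   spans a proper flat. *)
have [G fG hG] : exists2 G, G \in flats M :\ ground M & forall i, a i != 0 -> i \in G.
  apply: proper_flat_supp => [|k']; first by have [] := sa.
  have [->|kk] := eqVneq k' k.
    exists (elt k jm); rewrite ?elt_in // /a ext_elt ejm -/mu subrr add0r.
    by rewrite (max_idPl _) // oppr_le0 ltW.
  have [i ik' ik] := basis_diff kk.
  by exists i => //; rewrite /a ext_out.
by have [v hv] := flow_gt0 (fun=> lexx 0) mu0 fG hG; exists v; rewrite gt_eqF.
Qed.

Lemma spread_continuous (Y : topologicalType) (d : Y -> 'I_m.+1 -> R) k v :
  (forall j, continuous (fun y => d y j)) -> continuous (fun y => spread k (d y) v).
Proof.
move=> cd; have cm := min_coord_continuous cd.
have cmax (f : Y -> R) : continuous f -> continuous (fun y => Num.max 0 (f y)).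
  by move=> cf; apply: continuous_maxf => //; exact: continuousC.
apply: flow_continuous => [i|F|]; [|exact: continuousC|exact: cmax].
apply: continuous_bigf => [f g cf cg||j _]; first exact: continuousDf.
  exact: continuousC.
by apply: continuousDf; [exact: continuousBf | apply: cmax; exact: continuousNf].
Qed.

Definition expand_summand k (z : sphere R m.+1) : X :=
  normalize (spread_cone k (shear_nonzero z)).

Definition expand : W -> X := wedge_fun expand_summand.

(** At (1, ..., 1) the weights on the basis vanish and the time is 1, whatever the basis; all mass
    is at the vertex of [cl M set0]. *)
Lemma expand_base k k' :
  expand_summand k (sphere_base R m) = expand_summand k' (sphere_base R m).
Proof.
apply: (@normalize_eq _ _ _ _ _ _ _ 1) => // v; rewrite mul1r /spread.
congr (flow M _ _ _ v); apply/funext => i.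
have mu1 : min_coord (shear (val (sphere_base R m))) = 1.
  by apply: min_coordP => [j|]; [|exists ord0]; rewrite shear_base.
by rewrite /ext !big1 // => j _; rewrite shear_base mu1 subrr add0r max_l // oppr_le0.
Qed.

Lemma expand_lift k z : expand (lift k z) = expand_summand k z.
Proof. by apply: wedge_lift_funE => i j; exact: expand_base. Qed.

Lemma expand_continuous : continuous expand.
Proof.
apply: wedge_fun_continuous => [k|k k']; last exact: expand_base.
apply: normalize_continuous => v; apply: spread_continuous => j.
exact: shear_continuous.
Qed.

(* Clipping the time makes the homotopies continuous on all of [X * R]. *)
Definition clip (t : R) : R := Num.max 0 (Num.min 1 t).

Lemma clip_itv t : 0 <= clip t <= 1.
Proof. by rewrite /clip le_max lexx ge_max ler01 ge_min lexx. Qed.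

Lemma clip0 : clip 0 = 0.
Proof. by rewrite /clip min_r // maxxx. Qed.

Lemma clip1 : clip 1 = 1.
Proof. by rewrite /clip minxx max_r. Qed.

Lemma clip_continuous : continuous clip.
Proof.
apply: continuous_maxf; first exact: continuousC.
by apply: continuous_minf; [exact: continuousC | move=> t; exact: cvg_id].
Qed.

(** On the realization at most one term is nonzero; the sum gives its value without choosing a
    basis, so continuity is immediate. *)
Definition low_sum (x : V -> R) : R := \sum_k low k x.

Lemma low_sum_eq (x : X) k : 0 < low k (val x) -> low_sum (val x) = low k (val x).
Proof.
move=> h; rewrite /low_sum (bigD1 k) //= big1 ?addr0 // => k' kk.
exact: low_gt0_uniq h kk.
Qed.

Lemma low_sumP (x : X) :
  (low_sum (val x) = 0 /\ forall k, low k (val x) = 0) \/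
  exists2 k, 0 < low k (val x) & low_sum (val x) = low k (val x).
Proof.
have [/existsP[k h]|] := boolP [exists k, 0 < low k (val x)].
  by right; exists k => //; exact: low_sum_eq.
rewrite negb_exists => /forallP h; left.
have e k : low k (val x) = 0 by apply: le_anti; rewrite low_ge0 andbT leNgt h.
by split=> //; rewrite /low_sum big1.
Qed.

Lemma low_sum_ge0 (x : X) : 0 <= low_sum (val x).
Proof. by apply: sumr_ge0 => k _; exact: low_ge0. Qed.

(** Interpolates between [- low_sum x] at s = 1, where nothing flows, and the minimal coordinate of
    [pinch] at s = 0. Outside the open basis simplices it is 1 - s. *)
Definition level s (x : V -> R) : R :=
  - s * low_sum x + (1 - s) * (1 - 2 * n * low_sum x).

(** The excess over the minimum is rescaled, and a negative level is given back as the new minimum.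
    The cap [2 n x_i] does not bind on a basis with positive [low], and it keeps the support inside
    that of [x]. *)
Definition slide_y s (x : V -> R) (i : T) : R :=
  (s + (1 - s) * low_sum x) * Num.max 0 (x (inl i) - low_sum x)
  + Num.min (Num.max 0 (- level s x)) (2 * n * x (inl i)).

(* Since [level] is negative at the barycentres, the flow only starts at points
   whose [y]-support contains no basis. *)
Definition slide s (x : V -> R) : V -> R :=
  flow M (slide_y s x) (fun F => s * x (inr F)) (Num.max 0 (level s x)).

Section Slide.
Variables (x : X) (s : R).
Hypothesis s01 : 0 <= s <= 1.
Local Notation a i := ((val x : V -> R) (inl i)).
Local Notation l := (low_sum (val x)).

Lemma n_ge1 : (1 : R) <= n. Proof. by rewrite ler1n. Qed.

Lemma slide_y_ge0 i : 0 <= slide_y s (val x) i.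
Proof.
have /andP[s0 s1] := s01; have l0 := low_sum_ge0 x; have a0 := vertex_ge0 x (inl i).
rewrite addr_ge0 //.
  by rewrite mulr_ge0 ?le_max ?lexx // addr_ge0 // mulr_ge0 // subr_ge0.
by rewrite le_min le_max lexx /= mulr_ge0 // mulr_ge0.
Qed.

Lemma slide_y_supp i : slide_y s (val x) i != 0 -> a i != 0.
Proof.
apply: contraNneq => ai; have l0 := low_sum_ge0 x.
rewrite /slide_y ai mulr0 sub0r max_l ?oppr_le0 // mulr0 add0r min_r //.
by rewrite le_max lexx.
Qed.

Lemma slide_simplicial :
  simplicial M (slide_y s (val x)) (fun F => s * (val x : V -> R) (inr F)).
Proof.
apply: simplicial_sub (vertex_simplicial x) _ _ => [i|F]; first exact: slide_y_supp.
by apply: contraNneq => ->; rewrite mulr0.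
Qed.

Lemma slide_cone : cone (aug_bergman M) (slide s (val x)).
Proof.
have /andP[s0 s1] := s01; have l0 := low_sum_ge0 x; have n1 := n_ge1.
apply: flow_cone slide_simplicial _ _.
- exact: slide_y_ge0.
- by move=> F; rewrite mulr_ge0 // vertex_ge0.
- by rewrite le_max lexx.
have [lv|lv] := ltP 0 (level s (val x)).
  have [G fG hG] : exists2 G, G \in flats M :\ ground M &
      forall i, slide_y s (val x) i != 0 -> i \in G.
    apply: proper_flat_supp => [|k]; first by have [] := slide_simplicial.
    have [[e0 /(_ k) ek]|[k' hk' el]] := low_sumP x.
      move: ek; rewrite /low; have [j <-] := min_coord_ex (fun j => a (elt k j)) => ek.
      exists (elt k j); rewrite ?elt_in //; apply/eqP/negPn/negP => /slide_y_supp.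
      by rewrite ek eqxx.
    have [->|kk] := eqVneq k k'; last first.
      have [i ik' ik] := basis_diff kk.
      exists i => //; apply/eqP/negPn/negP => /slide_y_supp.
      by rewrite (low_gt0_out hk' ik) eqxx.
    (* At a positive level nothing is given back, so the minimal coordinate goes to 0. *)
    have [j ej] := min_coord_ex (fun j => a (elt k' j)).
    exists (elt k' j); rewrite ?elt_in // /slide_y ej -/(low k' _) el subrr maxxx mulr0 add0r.
    by rewrite max_l ?oppr_le0 ?(ltW lv) // min_l // mulr_ge0 // ltW.
  have c0 F : 0 <= s * (val x : V -> R) (inr F) by rewrite mulr_ge0 // vertex_ge0.
  by have [v hv] := flow_gt0 c0 lv fG hG; exists v; rewrite gt_eqF.
(* At a nonpositive level the time is 0, so some weight must be positive already. Outside the open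
   basis simplices [s = 1] and nothing moves. Inside one, a coordinate above the minimum survives,
   unless the point is the barycentre, where the level is negative. *)
have [v xv] := realization_neq0 x.
have [[e0 ek]|[k hk el]] := low_sumP x.
  have es : s = 1.
    apply: le_anti; rewrite s1 /=; move: lv; rewrite /level e0; lra.
  exists v; rewrite flow0; last exact: slide_y_ge0.
  case: v xv => [i|F] /= xv; last by rewrite es mul1r.
  rewrite /slide_y e0 subr0 es mulr0 addr0 mul1r.
  have h : 0 < a i by rewrite lt_neqAle eq_sym xv vertex_ge0.
  rewrite gt_eqF // ltr_wpDr // ?lt_max ?h ?orbT //.
  by rewrite le_min le_max lexx mulr_ge0 ?mulr_ge0 ?vertex_ge0.
have min_ge0 i : 0 <= Num.min (Num.max 0 (- level s (val x))) (2 * n * a i).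
  by rewrite le_min le_max lexx !mulr_ge0 ?vertex_ge0.
have [[j hj]|hj] := pselect (exists j, low k (val x) < a (elt k j)).
  exists (inl (elt k j)); rewrite flow0; last exact: slide_y_ge0.
  rewrite /slide_y el gt_eqF // ltr_wpDr // mulr_gt0 ?lt_max ?subr_gt0 ?hj ?orbT //.
  move: s0; rewrite le_eqVlt => /predU1P[<-|sp]; first by rewrite add0r subr0 mul1r.
  by rewrite ltr_wpDr // mulr_ge0 ?subr_ge0 // ltW.
have ea j : a (elt k j) = low k (val x).
  apply: le_anti; rewrite low_le ?elt_in // andbT leNgt.
  by apply/negP => h; apply: hj; exists j.
have nl := low_gt0_sum hk; rewrite (sum_const ea) in nl.
have ll : level s (val x) < 0.
  by rewrite /level el -mulrA nl; nra.
exists (inl (elt k ord0)); rewrite flow0; last exact: slide_y_ge0.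
rewrite /slide_y ea el subrr maxxx mulr0 add0r gt_eqF // lt_min lt_max oppr_gt0 ll orbT /=.
by rewrite -mulrA nl mulr1.
Qed.

Lemma slide1 v : slide 1 (val x) v = (val x : V -> R) v.
Proof.
have l0 := low_sum_ge0 x; have n1 := n_ge1.
have lv : level 1 (val x) = - l by rewrite /level subrr mul0r addr0 mulN1r.
have ea i : slide_y 1 (val x) i = a i.
  rewrite /slide_y lv opprK subrr mul0r addr0 mul1r (max_r l0).
  have [[-> _]|[k hk el]] := low_sumP x.
    by rewrite subr0 max_r ?vertex_ge0 // min_l ?addr0 // !mulr_ge0 ?vertex_ge0.
  have [ik|ik] := boolP (i \in basis k).
    have la : l <= a i by rewrite el low_le.
    by rewrite max_r ?subr_ge0 // min_l ?subrK //; nra.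
  by rewrite (low_gt0_out hk ik) mulr0 sub0r max_l ?oppr_le0 // min_r // addr0.
rewrite /slide lv max_l ?oppr_le0 // flow0 => [|i]; last by rewrite ea vertex_ge0.
by case: v => [i|F]; rewrite ?ea ?mul1r.
Qed.

End Slide.

Lemma low_sum_selected (x : X) : low_sum (val x) = low (selected (val x)) (val x).
Proof.
have [[-> ->] //|[k hk ->]] := low_sumP x.
have [->//|/selectedP h] := eqVneq k (selected (val x)).
by rewrite h ltxx in hk.
Qed.

(** [dir] rescales the pinched vector by some [c > 0]; by [flowZ] the two families of weights differ
    by that factor. *)
Lemma slide0 (x : X) (cx : cone (aug_bergman M) (slide 0 (val x))) :
  normalize cx = expand (collapse x).
Proof.
rewrite /collapse expand_lift; set k := selected _.
set nz := pinch_nonzero x k.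
have [c c0 ed] := shear_dir nz.
have l0 := low_sum_ge0 x; have n1 := n_ge1.
apply: (@normalize_eq _ _ _ _ _ _ _ c) => // v.
have /funext -> : shear (val (dir nz)) =1 (fun j => c * pinch (val x) k j) by [].
rewrite /spread.
have el : low k (val x) = low_sum (val x) by rewrite low_sum_selected.
have lvE : level 0 (val x) = 1 - 2 * n * low_sum (val x).
  by rewrite /level oppr0 mul0r add0r addr0 mul1r.
have mu : min_coord (pinch (val x) k) = level 0 (val x).
  rewrite lvE; apply: min_coordP => [j|].
    rewrite /pinch el lerDr mulr_ge0 // subr_ge0 -el.
    by apply: low_le; exact: elt_in.
  have [j ej] := min_coord_ex (fun j => (val x : V -> R) (inl (elt k j))).
  by exists j; rewrite /pinch ej -/(low k _) subrr mulr0 add0r el.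
have mc : min_coord (fun j => c * pinch (val x) k j) = c * level 0 (val x).
  apply: min_coordP => [j|]; first by rewrite ler_pM2l // -mu min_coord_le.
  by have [j ej] := min_coord_ex (pinch (val x) k); exists j; rewrite ej mu.
have maxZ (z : R) : Num.max 0 (c * z) = c * Num.max 0 z.
  by rewrite maxr_pMr ?mulr0 // ltW.
rewrite mc -mulrN !maxZ.
rewrite (@extP k _ (fun i => c * slide_y 0 (val x) i)) => [|j|i ik].
- rewrite -flowZ ?ltW //; congr (flow M _ _ _ v).
  by apply/funext => F; rewrite mul0r mulr0.
- have la : low_sum (val x) <= (val x : V -> R) (inl (elt k j)).
    by rewrite -el low_le // elt_in.
  rewrite /slide_y /pinch el add0r subr0 mul1r lvE (max_r (_ : 0 <= _ - _)) ?subr_ge0 //.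
  rewrite min_l; first by ring.
  have h : 2 * n * low_sum (val x) <= 2 * n * (val x : V -> R) (inl (elt k j)).
    by rewrite ler_wpM2l // mulr_ge0.
  rewrite ge_max !mulr_ge0 ?vertex_ge0 // andTb; lra.
- have [xi|xi] := eqVneq (slide_y 0 (val x) i) 0; first by rewrite xi mulr0.
  have ai := slide_y_supp xi; have [lk|lk] := eqVneq (low_sum (val x)) 0.
    move: xi; rewrite /slide_y lvE lk mulr0 addr0 mul0r add0r mulr0 subr0.
    rewrite (max_l (_ : -1 <= 0)) ?oppr_le0 // min_l ?eqxx //.
    by rewrite !mulr_ge0 ?vertex_ge0.
  have lp : 0 < low k (val x) by rewrite el lt_neqAle eq_sym lk.
  by rewrite (low_gt0_out lp ik) eqxx in ai.
Qed.

Lemma slide_continuous (Y : topologicalType) (s : Y -> R) (x : Y -> V -> R) v :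
  continuous s -> (forall v, continuous (fun y => x y v)) ->
  continuous (fun y => slide (s y) (x y) v).
Proof.
move=> cs cx.
have cl : continuous (fun y => low_sum (x y)).
  apply: continuous_bigf => [f g|//|k _]; first exact: continuousDf.
    exact: continuousC.
  exact: low_continuous.
have cc (c : R) : continuous (fun _ : Y => c) by exact: continuousC.
have cs1 : continuous (fun y => 1 - s y) by exact: continuousBf.
have cnl : continuous (fun y => 2 * n * low_sum (x y)) by exact: continuousMf.
have clv : continuous (fun y => level (s y) (x y)).
  apply: continuousDf; first by apply: continuousMf => //; exact: continuousNf.
  by apply: continuousMf => //; exact: continuousBf.
have cmax (f : Y -> R) : continuous f -> continuous (fun y => Num.max 0 (f y)).
  by move=> cf; exact: continuous_maxf.
apply: flow_continuous => [i|F|]; [|exact: continuousMf|exact: cmax].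
apply: continuousDf.
  apply: continuousMf; last by apply: cmax; exact: continuousBf.
  by apply: continuousDf => //; exact: continuousMf.
apply: continuous_minf; first by apply: cmax; exact: continuousNf.
by exact: continuousMf.
Qed.

Lemma slide_homotopic : homotopic R (expand \o collapse) (idfun : X -> X).
Proof.
exists (fun xt => normalize (slide_cone xt.1 (clip_itv xt.2))); split.
  apply: continuous_subspaceT; apply: normalize_continuous => v.
  apply: slide_continuous => [xt|w xt].
    apply: (@continuous_comp _ _ _ snd clip); first exact: cvg_snd.
    exact: clip_continuous.
  apply: (@continuous_comp _ _ _ fst (fun x : X => (val x : V -> R) w)).
    exact: cvg_fst.
  exact: vertex_continuous.
move=> x; split=> /=.
  by move: (slide_cone _ _); rewrite clip0 => cx; exact: slide0.
move: (slide_cone _ _); rewrite clip1 => cx.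
apply: realization_inj => v /=.
by rewrite slide1 (eq_bigr _ (fun w _ => slide1 x w)) realization_sum divr1.
Qed.

(** * The homotopy from [collapse \o expand] to the identity *)

Definition mass k (d : 'I_m.+1 -> R) : R := \sum_v spread k d v.

(* Linear interpolation between the coordinates of [d] and those of
   [pinch (spread k d) k] along [d - min_coord d] and (1, ..., 1). *)
Definition round k (d : 'I_m.+1 -> R) s : 'I_m.+1 -> R := fun j =>
  (s + (1 - s) * (Num.max 0 (- min_coord d) / mass k d ^+ 2)) * (d j - min_coord d)
  + (s * min_coord d + (1 - s) * (1 - 2 * n * (Num.max 0 (- min_coord d) / mass k d))).

Lemma mass_gt0 k d : nonzero d -> 0 < mass k d.
Proof. by case/(spread_cone k). Qed.

Lemma mass_const k (d : 'I_m.+1 -> R) c : c < 0 -> (forall j, d j = c) -> mass k d = n * - c.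
Proof.
move=> c0 dc; have mu : min_coord d = c.
  by apply: min_coordP => [j|]; [rewrite dc | exists ord0].
rewrite /mass /spread mu (max_l (ltW c0)).
have a0 i : 0 <= ext k (fun j => d j - c + Num.max 0 (- c)) i.
  by apply: ext_ge0 => j; rewrite dc subrr add0r le_max lexx.
rewrite big_sumType /= [X in _ + X]big1 => [|F _]; last by rewrite level_weight0 addr0.
rewrite addr0 (bigID (mem (basis k))) /= [X in _ + X]big1 => [|i ik]; last first.
  by rewrite ext_out // subr0 maxxx.
rewrite addr0 sum_basis; apply: sum_const => j.
by rewrite ext_elt dc subrr add0r subr0 !max_r // ?le_max ?lexx // oppr_ge0 ltW.
Qed.

(** At a minimal coordinate the constant term must vanish. For a minimum >= 0 this forces s = 1 and
    a zero minimum, hence d = 0. For a negative minimum the coefficient of [d j - min_coord d] is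
    positive, so [d] is constant; it is sent to the barycentre, where 2 n l = 2, and the constant
    term is negative. *)
Lemma round_nonzero k d s : 0 <= s <= 1 -> nonzero d -> nonzero (round k d s).
Proof.
move=> /andP[s0 s1] nd; apply: contrapT => h.
have e j : round k d s j = 0 by apply/eqP/negPn/negP => hj; apply: h; exists j.
have S0 := mass_gt0 k nd; have n1 := n_ge1.
move: e; rewrite /round; set mu := min_coord d; set S := mass k d in S0 *.
set al := s + _; set nu := s * mu + _ => e.
have [j0 ej0] := min_coord_ex d.
have nu0 : nu = 0 by have := e j0; rewrite ej0 -/mu subrr mulr0 add0r.
have [mup|mun] := leP 0 mu.
  move: nu0 e; rewrite /nu /al max_l ?oppr_le0 // !mul0r !mulr0 subr0 mulr1 addr0 => nu0 e.
  have s1' : s = 1 by nra.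
  have mu0 : mu = 0 by move: nu0; rewrite s1'; lra.
  have [j /eqP[]] := nd; have := e j.
  by rewrite nu0 addr0 s1' mul1r mu0 subr0.
have mp : Num.max 0 (- mu) = - mu by rewrite max_r // oppr_ge0 ltW.
have al0 : 0 < al.
  rewrite /al mp; have hq : 0 < - mu / S ^+ 2 by rewrite divr_gt0 ?exprn_gt0 ?oppr_gt0.
  move: s0; rewrite le_eqVlt => /predU1P[<-|sp]; first by rewrite add0r subr0 mul1r.
  by rewrite ltr_wpDr // mulr_ge0 ?subr_ge0 // ltW.
have dc j : d j = mu.
  apply/eqP; rewrite -subr_eq0; have /eqP := e j.
  by rewrite nu0 addr0 mulf_eq0 (gt_eqF al0).
have n0 : (n : R) != 0 by rewrite gt_eqF // (lt_le_trans ltr01).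
have eS : 2 * n * (- mu / S) = 2.
  rewrite /S (mass_const k mun dc); 
  by field; rewrite lt_eqF //= nat1r.
move: nu0; rewrite /nu mp eS => nu0.
have hs : s * mu <= 0 by rewrite mulr_ge0_le0 // ltW.
have es : s = 1 by lra.
by move: nu0; rewrite es; lra.
Qed.

Lemma low_spread k z k' :
  low k' (val (expand_summand k z)) = if k' == k then
    Num.max 0 (- min_coord (shear (val z))) / mass k (shear (val z)) else 0.
Proof.
set d := shear _; set mu := min_coord d.
have S0 : 0 < mass k d by apply: mass_gt0; exact: shear_nonzero.
have [->|kk] := eqVneq k' k; last first.
  apply: le_anti; rewrite low_ge0 andbT.
  have [i ik' ik] := basis_diff kk.
  apply: le_trans (low_le _ ik') _; rewrite /= ext_out // sub0r max_l ?mul0r //.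
  by rewrite oppr_le0 le_max lexx.
have e j : (val (expand_summand k z) : V -> R) (inl (elt k j)) =
    Num.max 0 (d j - mu + Num.max 0 (- mu) - Num.max 0 mu) / mass k d.
  by rewrite /= ext_elt.
apply: min_coordP => [j|].
  rewrite e ler_pM2r ?invr_gt0 // le_max; apply/orP; have dj := min_coord_le d j.
  have [h|h] := leP 0 mu; first by left; rewrite max_l // oppr_le0.
  by right; rewrite subr0 lerDr subr_ge0.
have [j ej] := min_coord_ex d; exists j; rewrite e ej subrr add0r.
have [h|h] := leP 0 mu.
  by rewrite (max_l (_ : - mu <= 0)) ?oppr_le0 // sub0r max_l ?oppr_le0.
by rewrite subr0 (max_r (_ : 0 <= Num.max _ _)) // le_max lexx.
Qed.

Lemma collapse_expand k z :
  collapse (expand_summand k z) = lift k (dir (pinch_nonzero (expand_summand k z) k)).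
Proof. by apply: collapseE => k' /negPf kk; rewrite low_spread kk. Qed.

Lemma round0 k (z : sphere R m.+1) j :
  round k (shear (val z)) 0 j = pinch (val (expand_summand k z)) k j.
Proof.
rewrite /pinch low_spread eqxx /round mul0r !add0r subr0 !mul1r; congr (_ + _).
set d := shear _; set mu := min_coord d.
have -> : (val (expand_summand k z) : V -> R) (inl (elt k j)) =
    Num.max 0 (d j - mu + Num.max 0 (- mu) - Num.max 0 mu) / mass k d.
  by rewrite /= ext_elt.
have [h|h] := leP 0 mu; first by rewrite max_l ?oppr_le0 // !mul0r.
have dj : mu <= d j := min_coord_le d j.
rewrite (max_r (_ : 0 <= - mu)) ?oppr_ge0 ?(ltW h) // subr0.
rewrite max_r; last by rewrite addr_ge0 ?subr_ge0 // oppr_ge0 ltW.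
by rewrite expr2 invfM; ring.
Qed.

Lemma round1 k d j : round k d 1 j = d j.
Proof. by rewrite /round subrr !mul0r !addr0 !mul1r subrK. Qed.

(** Fixing the base point throughout lets the homotopies of the summands glue. *)
Lemma round_base k s j : 0 <= s <= 1 -> round k (shear (val (sphere_base R m))) s j = 1.
Proof.
move=> s01; have mu : min_coord (shear (val (sphere_base R m))) = 1.
  by apply: min_coordP => [i|]; [|exists ord0]; rewrite shear_base.
rewrite /round mu shear_base subrr mulr0 add0r max_l ?oppr_le0 //.
by rewrite mul0r mulr0 subr0 !mulr1 addrC subrK.
Qed.

Lemma round_continuous (Y : topologicalType) (d : Y -> 'I_m.+1 -> R) (s : Y -> R) k j :
  (forall y, nonzero (d y)) -> (forall j, continuous (fun y => d y j)) ->
  continuous s -> continuous (fun y => round k (d y) (s y) j).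
Proof.
move=> nd cd cs; have cm := min_coord_continuous cd.
have cS : continuous (fun y => mass k (d y)).
  apply: continuous_bigf => [f g cf cg||v _]; first exact: continuousDf.
    exact: continuousC.
  exact: spread_continuous.
have cc (c : R) : continuous (fun _ : Y => c) by exact: continuousC.
have S0 y : mass k (d y) != 0 by rewrite gt_eqF // mass_gt0.
have cn : continuous (fun y => Num.max 0 (- min_coord (d y))).
  by apply: continuous_maxf => //; exact: continuousNf.
have cs1 : continuous (fun y => 1 - s y) by exact: continuousBf.
apply: continuousDf.
  apply: continuousMf; last exact: continuousBf.
  apply: continuousDf => //; apply: continuousMf => //; apply: continuousMf => //.
  apply: continuousVf => [y|]; first by rewrite expf_neq0.
  exact: (continuousMf cS cS).
apply: continuousDf; first exact: continuousMf.
apply: continuousMf => //; apply: continuousBf => //; apply: continuousMf => //.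
by apply: continuousMf => //; exact: continuousVf.
Qed.

Local Notation proj k w := (@wedge_proj _ _ (fun _ : 'I_b => sphere_base R m) k w).

Definition round_dir k (wt : W * R) : sphere R m.+1 :=
  dir (round_nonzero k (clip_itv wt.2) (shear_nonzero (proj k wt.1))).

Lemma round_homotopic : homotopic R (collapse \o expand) (idfun : W -> W).
Proof.
(* A summand is chosen for each point, with no continuity; [wedge_continuous] allows this because
   all other components are at the base point. *)
have [ix hix] : {ix : W -> 'I_b | forall w, exists z, w = lift (ix w) z}.
  exists (fun w => projT1 (cid (wedge_liftP w))) => w.
  by case: cid => k /= [z ->]; exists z.
have projE k z : proj k (lift k z) = z by rewrite wedge_proj_lift dfwithin.
exists (fun wt => lift (ix wt.1) (round_dir (ix wt.1) wt)); split.
  apply: continuous_subspaceT.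
  apply: (@wedge_continuous b _ _ (fun=> @closed_sphere_base R m) _ _ round_dir) => [k|[w t]].
    apply: dir_continuous => j; apply: round_continuous => [wt|i wt|wt].
    - exact: shear_nonzero.
    - apply: (@continuous_comp _ _ _ (fun wt : W * R => proj k wt.1)
        (fun z : sphere R m.+1 => shear (val z) i)); last exact: shear_continuous.
      apply: (@continuous_comp _ _ _ fst (fun w : W => proj k w)); first exact: cvg_fst.
      by apply: wedge_proj_continuous.
    - apply: (@continuous_comp _ _ _ snd clip); first exact: cvg_snd.
      exact: clip_continuous.
  exists (ix w) => // k kk; have [z ez] := hix w.
  apply: (@dir_const _ _ _ _ 1) => // j /=.
  rewrite {1}ez wedge_proj_lift dfwithout 1?eq_sym //.
  exact/round_base/clip_itv.
move=> w; have [z ez] := hix w.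
have ee : expand w = expand_summand (ix w) z by rewrite {1}ez expand_lift.
have pj : proj (ix w) w = z by rewrite {2}ez projE.
split=> /=.
  rewrite ee collapse_expand; congr (lift _ _).
  apply: (@dir_eq _ _ _ _ _ _ 1) => // j /=; rewrite mul1r clip0.
  by rewrite pj round0.
rewrite [RHS]ez; congr (lift _ _); rewrite -[RHS]dir_shear; first exact: shear_nonzero.
move=> nz; apply: (@dir_eq _ _ _ _ _ _ 1) => // j /=; rewrite mul1r clip1 round1.
by rewrite pj.
Qed.

Lemma aug_bergman_wedge : homotopy_equivalent R X W.
Proof.
exists collapse, expand; split.
- exact: collapse_continuous.
- exact: expand_continuous.
- exact: slide_homotopic.
- exact: round_homotopic.
Qed.

End Equivalence.

Local Open Scope ring_scope.

Lemma aug_bergman_sphere_wedge (R : realType) (T : finType) (M : matroid T) :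
  homotopy_equivalent R (realization R (aug_bergman M))
    (sphere_wedge R #|bases M| (rk M (ground M))).
Proof.
move: (erefl (rk M (ground M))); case: {2 3}(rk M (ground M)) => [|m] rM /=.
  (* In rank 0 there is no vertex to carry mass, so both spaces are empty. *)
  have noX (x : realization R (aug_bergman M)) : False.
    have [v xv] := realization_neq0 x.
    have [ia fc _ _] := vertex_simplicial x; case: v xv => [i|F] xv.
      have := indep_card_leq ia; rewrite rM leqn0 cards_eq0 => /eqP/setP/(_ i).
      by rewrite !inE xv.
    have := fc F xv; rewrite 2!inE => /andP[nF fF].
    have : F \proper ground M by rewrite finset.properEneq nF flat_subset.
    by move=> /(flat_rk_proper fF (subxx _)); rewrite rM.
  have noS (z : sphere R 0) : False.
    case: z => z /= /set_mem; rewrite /sphere /= big_ord0 => /esym/eqP.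
    by rewrite oner_eq0.
  exists (fun x => match noX x with end), (fun z => match noS z with end).
  split; [by move=> x; case: (noX x) | by move=> z; case: (noS z)| |].
  - exists (fun xt => match noX xt.1 with end).
    by split; [move=> xt; case: (noX xt.1) | move=> x; case: (noX x)].
  - exists (fun zt => match noS zt.1 with end).
    by split; [move=> zt; case: (noS zt.1) | move=> z; case: (noS z)].
exact: aug_bergman_wedge.
Qed.

Theorem corollary1p2 (R : realType) (T : finType) (M : matroid T) :
  [/\ homotopy_equivalent R (realization R (aug_bergman M))
        (sphere_wedge R #|bases M| (rk M (ground M))),
      #|bases M|%:Z = (tutte M).[1, 1],
      #|bases M|%:Z = \sum_(F in flats M)
        (tutte (mrestriction M F)).[0, 1] * (tutte (mcontraction M F)).[1, 0],
      forall lt : rel {set T + {set T}}, flag_to_basis M lt ->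
        #|homology_facets (aug_bergman M) lt| = #|bases M|
    & forall lt : rel {set T + {set T}}, basis_to_flag M lt ->
        #|homology_facets (aug_bergman M) lt|%:Z = \sum_(F in flats M)
          (tutte (mrestriction M F)).[0, 1] * (tutte (mcontraction M F)).[1, 0]].
Proof.
split.
- exact: aug_bergman_sphere_wedge.
- by rewrite tutte11.
- exact: bases_convolution.
- exact: flag_to_basis_homology.
- move=> lt [tot [shB [shI [hB hI hlt]]]].
  exact: basis_to_flag_card tot hB hI hlt.
Qed.
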